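(* Let $T$ be a closed densely defined operator in $\mathfrak H$ with $\overline{\mathrm{ran}}\,T=\mathfrak H$. Then the following statements are equivalent: (i) $T^*T\le\lambda\,T^*B$ with $\mathrm{dom}\,B\subseteq\mathrm{dom}\,T\subseteq\mathrm{dom}\,\overline{B\upharpoonright\mathrm{dom}(T^*B)}$ for some $\lambda\ge0$ and some $B=B^*\ge0$; (ii) $T=A\,\overline{B\upharpoonright\mathrm{dom}(T^*B)}\in\mathcal L_l^{+2}(\mathfrak H)$ with $\overline{\mathrm{ran}}\,A=\mathfrak H$, for some $B=B^*\ge0$ and $A\in B^+(\mathfrak H)$; here the displayed product is the factorization required by membership in $\mathcal L_l^{+2}(\mathfrak H)$, i.e. $\overline{B\upharpoonright\mathrm{dom}(T^*B)}$ is nonnegative and selfadjoint; (iii) $T^*$ is $G$-quasi-affine to $S$ for some quasi-affinity $G$ and some $S=S^*\ge0$ with $\mathrm{dom}\,T\subseteq\mathrm{dom}\,\overline{B_F\upharpoonright\mathrm{dom}(T^*B_F)}$, where $B_F=G^{-1}S^{1/2}\,\overline{S^{1/2}(G^{-1})^*}$.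
   Context: $\mathfrak H$ is a complex Hilbert space; $B(\mathfrak H)$ denotes the bounded everywhere defined operators and $B^+(\mathfrak H)$ the nonnegative selfadjoint ones among them. $\mathcal L_l^{+2}(\mathfrak H)$ is the class of closed operators $T$ in $\mathfrak H$ of the form $T=AB$ with $A\in B^+(\mathfrak H)$ and $B=B^*\ge0$ (in general unbounded). A quasi-affinity is an injective $G\in B(\mathfrak H)$ with dense range; $T$ is $G$-quasi-affine to $S$ if $G$ is a quasi-affinity and $GT\subseteq SG$. Products of operators have their natural domains, $\upharpoonright$ denotes restriction and the overline of an operator denotes closure. For nonnegative selfadjoint operators $C,D$ and $\lambda\ge0$, $C\le\lambda D$ means $\mathrm{dom}\,D^{1/2}\subseteq\mathrm{dom}\,C^{1/2}$ and $\|C^{1/2}x\|\le\lambda^{1/2}\|D^{1/2}x\|$ for all $x\in\mathrm{dom}\,D^{1/2}$; writing such an inequality includes the assertion that both $C$ and $D$ are nonnegative and selfadjoint. *)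

(* Defs.v *)
From mathcomp Require Import all_boot all_order all_algebra.
From mathcomp Require Import sesquilinear complex.
From mathcomp Require Import all_classical all_reals all_analysis.

Set Implicit Arguments.
Unset Strict Implicit.
Unset Printing Implicit Defensive.

Import Order.TTheory GRing.Theory Num.Theory.
Import numFieldNormedType.Exports.

Local Open Scope classical_set_scope.
Local Open Scope ring_scope.
Local Open Scope complex_scope.

(* An unbounded operator in H is identified with its graph, a subset of H * H.
   Hence equality and inclusion of operators are equality and inclusion of
   sets, T.`1 and T.`2 are the domain and the range of T, and [closure T], in
   the product topology, is the closure of T; it is the graph of an operator
   exactly when T is closable. *)
Section Operators.
Variables (R : realType) (H : completeNormedModType R[i]).

Definition is_operator (T : set (H * H)) :=
  [/\ T 0,
      forall (a : R[i]) (u v : H * H), T u -> T v -> T (a *: u + v)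
    & forall x y z : H, T (x, y) -> T (x, z) -> y = z].

(* the product ST on its natural domain; the library's relational composition
   S \; T applies T first *)
Definition op_mul (S T : set (H * H)) : set (H * H) := (S \; T)%relation.

Definition op_inv (T : set (H * H)) : set (H * H) := (T^-1)%relation.

Definition dense_range (T : set (H * H)) := closure T.`2 = setT.

Definition densely_defined (T : set (H * H)) := closure T.`1 = setT.

Definition closed_operator (T : set (H * H)) := is_operator T /\ closed T.

Definition restrict_op (T : set (H * H)) (D : set H) : set (H * H) :=
  [set p | T p /\ D p.1].

Definition bounded_operator (T : set (H * H)) :=
  [/\ is_operator T, T.`1 = setT
    & exists c : R, forall x y : H, T (x, y) -> `|y| <= c%:C * `|x|].

Definition injective_op (T : set (H * H)) :=
  forall x y z : H, T (x, z) -> T (y, z) -> x = y.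

Definition quasi_affinity (G : set (H * H)) :=
  [/\ bounded_operator G, injective_op G & dense_range G].

(* T is G-quasi-affine to S *)
Definition quasi_affine (G T S : set (H * H)) :=
  quasi_affinity G /\ op_mul G T `<=` op_mul S G.

Section InnerProduct.
Variable dot : {dot H for @Num.conj R[i]}.

Definition adjoint (T : set (H * H)) : set (H * H) :=
  [set p | forall u v : H, T (u, v) -> dot v p.1 = dot u p.2].

Definition selfadjoint (T : set (H * H)) :=
  [/\ is_operator T, densely_defined T & adjoint T = T].

Definition nonneg_selfadjoint (T : set (H * H)) :=
  selfadjoint T /\ forall x y : H, T (x, y) -> 0 <= dot y x.

Definition bounded_nonneg (T : set (H * H)) :=
  bounded_operator T /\ nonneg_selfadjoint T.

(* A nonnegative selfadjoint operator has exactly one nonnegative selfadjoint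
   square root, so the choice made by xget is immaterial for such C. *)
Definition op_sqrt (C : set (H * H)) : set (H * H) :=
  xget set0 [set Q | nonneg_selfadjoint Q /\ op_mul Q Q = C].

(* C <= lambda D *)
Definition op_le (C : set (H * H)) (lambda : R) (D : set (H * H)) :=
  [/\ nonneg_selfadjoint C, nonneg_selfadjoint D,
      (op_sqrt D).`1 `<=` (op_sqrt C).`1
    & forall x y z : H, op_sqrt C (x, y) -> op_sqrt D (x, z) ->
        `|y| <= (Num.sqrt lambda)%:C * `|z|].

(* T = AB is a factorization witnessing that T is in L_l^{+2}(H) *)
Definition Ll2_factorization (T A B : set (H * H)) :=
  [/\ closed_operator T, bounded_nonneg A, nonneg_selfadjoint B
    & T = op_mul A B].

Definition restr_closure (T B : set (H * H)) : set (H * H) :=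
  closure (restrict_op B (op_mul (adjoint T) B).`1).

(* G^{-1} S^{1/2} closure(S^{1/2} (G^{-1})* ) *)
Definition op_BF (G S : set (H * H)) : set (H * H) :=
  op_mul (op_inv G)
    (op_mul (op_sqrt S) (closure (op_mul (op_sqrt S) (adjoint (op_inv G))))).

End InnerProduct.
End Operators.

(* Main.v *)
Require Import Defs.
From mathcomp Require Import all_boot all_order all_algebra.
From mathcomp Require Import sesquilinear complex.
From mathcomp Require Import all_classical all_reals all_analysis.
From mathcomp Require Import ring lra.

Set Implicit Arguments.
Unset Strict Implicit.
Unset Printing Implicit Defensive.

Import Order.TTheory GRing.Theory Num.Theory.
Import numFieldNormedType.Exports.

Local Open Scope classical_set_scope.
Local Open Scope ring_scope.
Local Open Scope complex_scope.

Local Notation normc := ComplexField.Normc.normc.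

(** An operator is its graph, and closures are handled by orthogonality: the
    projection theorem in H * H identifies the closure of a linear relation X
    with its second adjoint ([adjointK]), so that a statement about limits
    becomes a linear identity to be checked on X alone ([closure_annihilator],
    [closure_biorthogonal]). Two classical facts carry the rest. The first is
    von Neumann's theorem [von_neumann]: for a closed densely defined X the
    product (adj X) X is nonnegative and selfadjoint. It is proved for linear
    relations X, possibly multivalued, because the factor
    X = S^{1/2} (adj G^{-1}) of the operator B_F need not be closable. The
    second is the existence of square roots [nonneg_sqrt_exists], which gives
    with [sqrt_modulus] the description of the square root Q of (adj L) L for
    a closed operator L: Q and L have the same domain, and |Q x| = |L x|
    there. Hence (adj T) T <= c^2 (adj L) L amounts to dom L `<=` dom T and
    |T x| <= c |L x|.

    From the inequality to the factorization ([op_le_to_factorization]). The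
    two inclusions of domains force the closure of the restriction of B to be
    B itself. If Q is the square root of (adj T) B, then
    |T x| <= sqrt lambda |Q x| on dom ((adj T) B), so the closure W of the
    relation of all pairs (Q x, T x) is a bounded operator and A = W (adj W)
    is bounded and nonnegative. As <B x, T u> = <Q x, Q u>, adj W maps B x to
    Q x, hence A B x = T x on dom ((adj T) B). This is a core of B, and T is
    closed, so A B is contained in T; the domains agree.

    From the factorization to quasi-affinity
    ([factorization_to_quasi_affine]). Again the restriction of B has closure
    B. Take G = A^{1/2}, Z = B^{1/2} G and S = (adj Z) Z. Then
    adj T = B G G and G (adj T) is contained in S G. The point is that B_F is
    B, for which it is enough that the range of G meets dom B^{1/2} in a core
    of B^{1/2} ([sqrt_core]). This rests on adj Z = G B^{1/2}, that is, on the
    closedness of G B^{1/2}, which the resolvent of B^{1/2} reduces to that of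
    G B; and G B is closed because T = G (G B) is ([factor_closed]).

    From quasi-affinity to the inequality ([quasi_affine_to_op_le]). Take
    B = B_F. The inclusion of G (adj T) in S G yields that (adj G) G B_F is
    contained in T, and the hypothesis on domains turns this into an equality.
    Then L = G B_F is closed, (adj T) B_F = (adj L) L, and T = (adj G) L gives
    |T x| <= c |L x| with c a bound of adj G. *)

(** * Inner product, norm and topology *)

Section Hilbert.
Variables (R : realType) (H : completeNormedModType R[i]).
Variable dot : {dot H for @Num.conj R[i]}.
Hypothesis dot_norm : forall x : H, `|x| ^+ 2 = dot x x.

Implicit Types x y z u v w : H.

Lemma dotDl x y z : dot (x + y) z = dot x z + dot y z.
Proof. exact: linearDl. Qed.
Lemma dotBl x y z : dot (x - y) z = dot x z - dot y z.
Proof. exact: linearBl. Qed.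
Lemma dotNl x z : dot (- x) z = - dot x z.
Proof. exact: linearNl. Qed.
Lemma dot0l z : dot 0 z = 0.
Proof. exact: linear0l. Qed.
Lemma dotZl (a : R[i]) x z : dot (a *: x) z = a * dot x z.
Proof. exact: linearZl_LR. Qed.
Lemma dotDr x y z : dot z (x + y) = dot z x + dot z y.
Proof. exact: linearDr. Qed.
Lemma dotBr x y z : dot z (x - y) = dot z x - dot z y.
Proof. exact: linearBr. Qed.
Lemma dotNr x z : dot z (- x) = - dot z x.
Proof. exact: linearNr. Qed.
Lemma dot0r z : dot z 0 = 0.
Proof. exact: linear0r. Qed.
Lemma dotZr (a : R[i]) x z : dot z (a *: x) = a^* * dot z x.
Proof. by rewrite linearZr_LR. Qed.
Lemma dotZrR (a : R) x z : dot z (a%:C *: x) = a%:C * dot z x.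
Proof. by rewrite dotZr; congr (_ * _); exact: conjc_real. Qed.
Lemma dotC x y : dot x y = (dot y x)^*.
Proof. by rewrite hermC expr0 mul1r. Qed.

(** The norm has values in R[i]; its real part lies in R, where infima, suprema
    and linear arithmetic are available. *)
Definition rnorm x : R := complex.Re `|x|.

Lemma norm_rnorm x : `|x| = (rnorm x)%:C.
Proof. by rewrite /rnorm RRe_real// normr_real. Qed.
Lemma rnorm_ge0 x : 0 <= rnorm x.
Proof. by rewrite -ler0c -norm_rnorm normr_ge0. Qed.
Lemma dotxx x : dot x x = (rnorm x ^+ 2)%:C.
Proof. by rewrite -dot_norm norm_rnorm rmorphXn. Qed.
Lemma rnormD x y : rnorm (x + y) <= rnorm x + rnorm y.
Proof. by rewrite -lecR rmorphD/= -!norm_rnorm ler_normD. Qed.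
Lemma rnormZ (a : R[i]) x : rnorm (a *: x) = normc a * rnorm x.
Proof. by apply: complexI; rewrite rmorphM/= -!norm_rnorm normrZ. Qed.
Lemma rnormN x : rnorm (- x) = rnorm x.
Proof. by rewrite /rnorm normrN. Qed.
Lemma rnorm0 : rnorm 0 = 0.
Proof. by rewrite /rnorm normr0. Qed.
Lemma rnorm_eq0 x : rnorm x = 0 -> x = 0.
Proof. by move=> e; apply/eqP; rewrite -normr_eq0 norm_rnorm e. Qed.
Lemma rnorm_le0 x : rnorm x <= 0 -> x = 0.
Proof. by move=> h; apply/rnorm_eq0/eqP; rewrite eq_le h rnorm_ge0. Qed.
Lemma rnormBC x y : rnorm (x - y) = rnorm (y - x).
Proof. by rewrite -rnormN opprB. Qed.
Lemma rnorm_triangle x y z : rnorm (x - z) <= rnorm (x - y) + rnorm (y - z).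
Proof. by apply: le_trans (rnormD _ _); rewrite addrA subrK. Qed.

Lemma dot_eq0 x : dot x x = 0 -> x = 0.
Proof.
rewrite dotxx => /complexI /eqP; rewrite sqrf_eq0 => /eqP; exact: rnorm_eq0.
Qed.

Definition rdot x y : R := complex.Re (dot x y).

Lemma rdotC x y : rdot x y = rdot y x.
Proof. by rewrite /rdot dotC; case: (dot y x). Qed.
Lemma rdotxx x : rdot x x = rnorm x ^+ 2.
Proof. by rewrite /rdot dotxx. Qed.
Lemma sqr_rnormD x y :
  rnorm (x + y) ^+ 2 = rnorm x ^+ 2 + rnorm y ^+ 2 + rdot x y *+ 2.
Proof.
rewrite -!rdotxx {1}/rdot dotDl !dotDr !raddfD/= -!/(rdot _ _) [rdot y x]rdotC.
by rewrite mulr2n; ring.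
Qed.
Lemma sqr_rnormB x y :
  rnorm (x - y) ^+ 2 = rnorm x ^+ 2 + rnorm y ^+ 2 - rdot x y *+ 2.
Proof. by rewrite sqr_rnormD rnormN /rdot dotNr raddfN mulNrn. Qed.

(** Expand the square of |y| x - |x| y. *)
Lemma rdot_le x y : rdot x y <= rnorm x * rnorm y.
Proof.
have [->|y0] := eqVneq y 0; first by rewrite rnorm0 mulr0 /rdot dot0r.
have n0 : 0 < rnorm y.
  rewrite lt_neqAle rnorm_ge0 andbT eq_sym.
  by apply: contra_neq y0; apply: rnorm_eq0.
have [x0|nx0] := eqVneq (rnorm x) 0.
  by rewrite x0 mul0r /rdot (rnorm_eq0 x0) dot0l.
have nx : 0 < rnorm x by rewrite lt_neqAle rnorm_ge0 andbT eq_sym.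
have := sqr_ge0 (rnorm ((rnorm y)%:C *: x - (rnorm x)%:C *: y)).
rewrite sqr_rnormB !rnormZ/= !expr0n/= !addr0 !sqrtr_sqr.
rewrite !ger0_norm ?rnorm_ge0//.
rewrite /rdot dotZl dotZr/=.
case: (dot x y) => a b /=.
rewrite !(oppr0,mul0r,subr0,mulr0,addr0) => h.
have : 0 <= (rnorm x * rnorm y) * (rnorm x * rnorm y - a).
  by move: h; rewrite mulr2n; lra.
by rewrite pmulr_rge0 ?subr_ge0// mulr_gt0.
Qed.

(** Multiplying y by <x, y> makes the inner product real, which reduces the
    modulus to the real part. *)
Lemma normc_dot x y : normc (dot x y) <= rnorm x * rnorm y.
Proof.
have [d0|d0] := eqVneq (dot x y) 0.
  by rewrite d0 ComplexField.Normc.normc0 mulr_ge0// rnorm_ge0.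
set m := normc _.
have m0 : 0 < m.
  rewrite lt_neqAle eq_sym /m andbC; apply/andP; split.
    by case: (dot x y) => a b; exact: sqrtr_ge0.
  by apply: contra_neq d0; exact: ComplexField.Normc.eq0_normc.
have := rdot_le x (dot x y *: y).
rewrite rnormZ -/m /rdot dotZr.
have -> : complex.Re ((dot x y)^* * dot x y) = m ^+ 2.
  rewrite mulrC -sqr_normc.
  by rewrite -[`|_|]/(m%:C) -rmorphXn.
rewrite expr2 mulrCA => h.
by rewrite -(ler_pM2l m0).
Qed.

Lemma closureP (A : set H) x : closure A x <->
  forall e : R, 0 < e -> exists2 a, A a & rnorm (x - a) < e.
Proof.
split=> [cA e e0|h B /nbhs_ballP [e /= e0 eB]].
  have /cA [a [Aa]] : nbhs x (ball x e%:C) by apply: nbhsx_ballx; rewrite ltcR.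
  by rewrite -ball_normE /= norm_rnorm ltcR => ?; exists a.
have er : e = (complex.Re e)%:C by rewrite RRe_real// gtr0_real.
have [|a Aa ax] := h (complex.Re e); first by rewrite -ltcR -er.
by exists a; split => //; apply: eB; rewrite -ball_normE /= norm_rnorm er ltcR.
Qed.

Lemma closure_pairP (A : set (H * H)) x y : closure A (x, y) <->
  forall e : R, 0 < e -> exists a b,
    [/\ A (a, b), rnorm (x - a) < e & rnorm (y - b) < e].
Proof.
split=> [cA e e0|h B /nbhs_ballP [e /= e0 eB]].
  have /cA [[a b] [Aa]] : nbhs (x, y) (ball (x, y) e%:C).
    by apply: nbhsx_ballx; rewrite ltcR.
  case; rewrite -!ball_normE /= !norm_rnorm !ltcR => ? ?; by exists a, b.
have er : e = (complex.Re e)%:C by rewrite RRe_real// gtr0_real.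
have [|a [b [Aa ax bx]]] := h (complex.Re e); first by rewrite -ltcR -er.
exists (a, b); split => //; apply: eB; split;
  by rewrite -ball_normE /= norm_rnorm er ltcR.
Qed.

Definition seq_cvg (u : nat -> H) l := forall e : R, 0 < e ->
  exists N, forall n, (N <= n)%N -> rnorm (u n - l) < e.

Lemma cauchy_seq_cvg (u : nat -> H) :
  (forall e : R, 0 < e -> exists N, forall n m, (N <= n)%N -> (N <= m)%N ->
     rnorm (u n - u m) < e) -> exists l, seq_cvg u l.
Proof.
move=> hu.
have /cauchy_cvgP cu : cauchy (u @ \oo).
  apply/cauchy_ballP => e e0; near_simpl.
  have er : e = (complex.Re e)%:C by rewrite RRe_real// gtr0_real.
  have [|N hN] := hu (complex.Re e); first by rewrite -ltcR -er.
  exists ([set n | (N <= n)%N], [set n | (N <= n)%N]).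
    by split; exists N.
  case=> n m [/= hn hm].
  by rewrite -ball_normE /= norm_rnorm er ltcR hN.
exists (lim (u @ \oo)) => e e0.
have /cvgrPdist_lt/(_ e%:C) := cu; rewrite ltcR => /(_ e0) [N _ hN].
exists N => n /hN; by rewrite /= norm_rnorm ltcR rnormBC.
Qed.

(** On V = H * H these are the linear relations in H, that is, operators without
    the requirement of single-valuedness. *)
Definition subspace (V : lmodType R[i]) (M : set V) :=
  M 0 /\ forall (a : R[i]) (u v : V), M u -> M v -> M (a *: u + v).

Section Subspace.
Variables (V : lmodType R[i]) (M : set V).
Hypothesis sM : subspace M.

Implicit Types p q : V.

Lemma subspaceD p q : M p -> M q -> M (p + q).
Proof. by move=> Mp Mq; rewrite -[p]scale1r; apply: sM.2. Qed.
Lemma subspaceZ a p : M p -> M (a *: p).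
Proof.
by move=> Mp; rewrite -[_ *: _]addr0; apply: sM.2 => //; exact: sM.1.
Qed.
Lemma subspaceN p : M p -> M (- p).
Proof. by move=> Mp; rewrite -scaleN1r; apply: subspaceZ. Qed.
Lemma subspaceB p q : M p -> M q -> M (p - q).
Proof. by move=> Mp Mq; apply: subspaceD => //; apply: subspaceN. Qed.
End Subspace.

Lemma normc_ge0 (a : R[i]) : 0 <= normc a.
Proof. by case: a => ? ?; exact: sqrtr_ge0. Qed.

Lemma normc_small (a : R[i]) (c : R) : 0 <= c ->
  (forall e : R, 0 < e -> normc a <= e * c) -> a = 0.
Proof.
move=> c0 h; apply: ComplexField.Normc.eq0_normc; apply/eqP.
rewrite eq_le normc_ge0 andbT; apply/ler_addgt0Pr => e e0; rewrite add0r.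
have c1 : 0 < c + 1 by rewrite ltr_wpDl.
apply: le_trans (h _ (divr_gt0 e0 c1)) _.
by rewrite -mulrA ler_piMr ?(ltW e0)// mulrC ler_pdivrMr// mul1r lerDl.
Qed.

Lemma normc_dotB x y a b :
  normc (dot x a - dot y b) <= rnorm x * rnorm a + rnorm y * rnorm b.
Proof.
rewrite -dotNr; have := @le_normcD R (dot x a) (dot y (- b)).
move=> /le_trans; apply; rewrite lerD ?normc_dot//.
by rewrite (le_trans (normc_dot _ _))// rnormN.
Qed.

(** A bounded linear identity passes to the closure. In most proofs below this
    replaces the choice of approximating sequences. *)
Lemma closure_annihilator (X : set (H * H)) x y a b : closure X (x, y) ->
  (forall u v, X (u, v) -> dot u a = dot v b) -> dot x a = dot y b.
Proof.
move=> /closure_pairP cX h; apply: subr0_eq.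
apply: (@normc_small _ (rnorm a + rnorm b)) => [|e e0].
  by rewrite addr_ge0// rnorm_ge0.
have [u [v [Xuv xu yv]]] := cX e e0.
have -> : dot x a - dot y b = dot (x - u) a - dot (y - v) b.
  by rewrite !dotBl (h _ _ Xuv); ring.
apply: le_trans (normc_dotB _ _ _ _) _.
by rewrite mulrDr lerD// ler_wpM2r ?rnorm_ge0// ltW.
Qed.

(** * Orthogonal projection in H * H *)

(** H * H carries the maximum norm, which has no parallelogram identity; this is
    the square of the equivalent Hilbert norm. *)
Definition sqn (p : H * H) : R := rnorm p.1 ^+ 2 + rnorm p.2 ^+ 2.

Lemma sqn_ge0 p : 0 <= sqn p.
Proof. by rewrite addr_ge0// sqr_ge0. Qed.

Lemma parallelogram p q : sqn (p + q) + sqn (p - q) = (sqn p + sqn q) *+ 2.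
Proof. by rewrite /sqn /= !sqr_rnormB !sqr_rnormD !mulr2n; ring. Qed.

Lemma sqnB p q :
  sqn (p - q) = sqn p + sqn q - (rdot p.1 q.1 + rdot p.2 q.2) *+ 2.
Proof. by rewrite /sqn /= !sqr_rnormB !mulr2n; ring. Qed.

Lemma rdotZr (a : R) x y : rdot x (a%:C *: y) = a * rdot x y.
Proof.
rewrite /rdot dotZr; case: (dot x y) => b c /=.
by rewrite oppr0 mul0r subr0.
Qed.

Lemma sqnZ (a : R) p : sqn (a%:C *: p) = a ^+ 2 * sqn p.
Proof.
by rewrite /sqn /= !rnormZ/= expr0n/= addr0 !exprMn sqr_sqrtr ?sqr_ge0// mulrDr.
Qed.

Lemma rnorm_lt_sqn (e : R) p : 0 <= e -> sqn p < e ^+ 2 ->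
  rnorm p.1 < e /\ rnorm p.2 < e.
Proof.
move=> e0; rewrite /sqn => h.
by split; rewrite -(@ltr_pXn2r _ 2) ?nnegrE ?rnorm_ge0//; apply: le_lt_trans h;
  rewrite ?lerDl ?lerDr sqr_ge0.
Qed.

Lemma inv_succ_small (e : R) : 0 < e ->
  exists N, forall n, (N <= n)%N -> n.+1%:R^-1 < e.
Proof.
move=> e0; exists (Num.trunc e^-1) => n Nn.
rewrite -[ltRHS]invrK ltf_pV2 ?posrE ?ltr0n ?invr_gt0//.
by apply: (lt_le_trans (truncnS_gt _)); rewrite ler_nat ltnS.
Qed.

(** By the parallelogram identity a minimizing sequence is a Cauchy sequence. *)
Lemma nearest_point (K : set (H * H)) p : closed K -> subspace K ->
  exists2 q, K q & forall r, K r -> sqn (p - q) <= sqn (p - r).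
Proof.
move=> cK sK.
pose E := [set sqn (p - q) | q in K].
have E0 : E !=set0 by exists (sqn (p - 0)), 0 => //; exact: sK.1.
have lE : has_lbound E by exists 0 => _ [q _ <-]; exact: sqn_ge0.
pose d := inf E.
have dE r : K r -> d <= sqn (p - r) by move=> Kr; apply: ge_inf => //; exists r.
have /choice [q hq] : forall n : nat,
    exists q, K q /\ sqn (p - q) < d + n.+1%:R^-1.
  move=> n; have [] := @inf_adherent _ E n.+1%:R^-1 _ (conj E0 lE).
    by rewrite invr_gt0 ltr0n.
  by move=> _ [q Kq <-] h; exists q.
have qq n m : sqn (q n - q m) <= (n.+1%:R^-1 + m.+1%:R^-1) *+ 2.
  have := parallelogram (p - q n) (p - q m).
  have -> : p - q n - (p - q m) = - (q n - q m).
    by rewrite !opprB addrC addrA subrK.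
  have -> : sqn (- (q n - q m)) = sqn (q n - q m) by rewrite /sqn /= !rnormN.
  pose r := (2^-1)%:C *: (q n + q m).
  have Kr : K r by apply: subspaceZ => //; apply: subspaceD => //; apply hq.
  have -> : p - q n + (p - q m) = 2%:C *: (p - r).
    rewrite /r scalerBr scalerA -rmorphM/= divff ?pnatr_eq0// scale1r.
    by rewrite rmorph_nat scaler_nat mulr2n; rewrite opprD addrACA.
  rewrite sqnZ.
  have := dE _ Kr; have := (hq n).2; have := (hq m).2.
  rewrite !mulr2n; set A := sqn (p - q n); set B := sqn (p - q m).
  set C := sqn (p - r); set D := sqn (q n - q m).
  by move: A B C D (n.+1%:R^-1) (m.+1%:R^-1) => A B C D e f; lra.
have small (e : R) : 0 < e -> exists N, forall n m, (N <= n)%N -> (N <= m)%N ->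
    sqn (q n - q m) < e ^+ 2.
  move=> e0; have [|N hN] := @inv_succ_small (e ^+ 2 / 4).
    by rewrite divr_gt0// exprn_gt0.
  exists N => n m nN mN.
  have := hN _ nN; have := hN _ mN; have := qq n m; rewrite mulr2n.
  set D := sqn _; move: D (n.+1%:R^-1) (m.+1%:R^-1) (e ^+ 2) => D a b c; lra.
have [|l1 h1] := @cauchy_seq_cvg (fun n => (q n).1).
  move=> e e0; have [N hN] := small e e0; exists N => n m nN mN.
  by have [] := rnorm_lt_sqn (ltW e0) (hN n m nN mN).
have [|l2 h2] := @cauchy_seq_cvg (fun n => (q n).2).
  move=> e e0; have [N hN] := small e e0; exists N => n m nN mN.
  by have [] := rnorm_lt_sqn (ltW e0) (hN n m nN mN).
have Kl : K (l1, l2).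
  rewrite ((closure_id K).1 cK); apply/closure_pairP => e e0.
  have [N1 hN1] := h1 e e0; have [N2 hN2] := h2 e e0.
  exists (q (maxn N1 N2)).1, (q (maxn N1 N2)).2; split.
  - by case: (q _) (hq (maxn N1 N2)) => ? ? [].
  - by rewrite rnormBC hN1 ?leq_maxl.
  - by rewrite rnormBC hN2 ?leq_maxr.
exists (l1, l2) => // r Kr; apply: le_trans (dE r Kr).
(* f is so small that replacing q n by its limit costs at most e / 2. *)
apply/ler_addgt0Pr => e e0.
pose c := rnorm (p - (l1, l2)).1 + rnorm (p - (l1, l2)).2 + 1.
have c0 : 0 < c by rewrite ltr_wpDl// addr_ge0// rnorm_ge0.
pose f := e / (4 * c).
have f_gt0 : 0 < f by rewrite divr_gt0// mulr_gt0.
have [N1 hN1] := h1 f f_gt0; have [N2 hN2] := h2 f f_gt0.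
have [N hN] : exists N, forall n, (N <= n)%N -> n.+1%:R^-1 < e / 2.
  by apply: inv_succ_small; rewrite divr_gt0.
pose n := maxn N (maxn N1 N2).
have hn := hN n (leq_maxl _ _).
have := (hq n).2; rewrite /sqn /=.
have hN1' : rnorm ((q n).1 - l1) < f.
  by apply: hN1; rewrite /n !leq_max leqnn orbT.
have hN2' : rnorm ((q n).2 - l2) < f.
  by apply: hN2; rewrite /n !leq_max leqnn !orbT.
have aux (s t l : H) : rnorm (t - l) < f ->
    rnorm (s - l) ^+ 2 <= rnorm (s - t) ^+ 2 + rnorm (s - l) * f *+ 2.
  move=> tl.
  have := rnorm_triangle s t l; have := rnorm_ge0 (s - l).
  have := rnorm_ge0 (s - t); have := rnorm_ge0 (t - l); move: tl.
  set A := rnorm (s - l); set B := rnorm (s - t); set C := rnorm (t - l).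
  move=> Cf C0 B0 A0 ABC; rewrite mulr2n !expr2.
  have [AB|AB] := leP A B.
    have : A * A <= B * B by rewrite ler_pM.
    have : 0 <= A * f by rewrite mulr_ge0// ltW.
    lra.
  have : (A - B) * (A + B) <= f * (A + A).
    by apply: ler_pM; rewrite ?subr_ge0 ?addr_ge0//; lra.
  lra.
have := aux p.1 _ _ hN1'; have := aux p.2 _ _ hN2'.
have : 4 * (c * f) = e.
  by rewrite /f; field; rewrite gt_eqF.
rewrite /c /= !mulr2n.
set A1 := rnorm (p.1 - l1); set A2 := rnorm (p.2 - l2).
set S1 := rnorm (p.1 - _); set S2 := rnorm (p.2 - _).
move: hn f_gt0; clear aux hN1 hN2 hN1' hN2'; move: (n.+1%:R^-1) f => x f.
by move: A1 A2 S1 S2 => A1 A2 S1 S2; lra.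
Qed.

(** Vary the nearest point q along q + t s with t real: the resulting quadratic
    inequality in t kills the real part of the inner product with s, and
    replacing s by i s kills the imaginary part. *)
Lemma orthogonal_projection (K : set (H * H)) p : closed K -> subspace K ->
  exists2 q, K q & forall r, K r -> dot (p - q).1 r.1 + dot (p - q).2 r.2 = 0.
Proof.
move=> cK sK; have [q Kq hq] := nearest_point p cK sK; exists q => // r Kr.
have re (s : H * H) : K s -> rdot (p - q).1 s.1 + rdot (p - q).2 s.2 = 0.
  move=> Ks; set b := _ + _.
  have key (t : R) : t * b *+ 2 <= t ^+ 2 * sqn s.
    have := hq (q + t%:C *: s) (subspaceD sK Kq (subspaceZ sK _ Ks)).
    rewrite opprD addrA [sqn (_ - _ *: _)]sqnB sqnZ /= !rdotZr !mulr2n /b.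
    set A := sqn _; set B := sqn _; set C := rdot _ _; set D := rdot _ _.
    by move: A B C D => A B C D; lra.
  have s0 := sqn_ge0 s.
  (* t = b / c, where the + 1 keeps c positive when s = 0 *)
  pose c := sqn s + 1.
  have c0 : 0 < c by rewrite ltr_wpDl.
  have := key (b / c).
  rewrite expr2 mulr2n => h.
  have : b ^+ 2 / c * (2 - sqn s / c) <= 0 by move: h; lra.
  have : 0 < 2 - sqn s / c.
    by rewrite subr_gt0 ltr_pdivrMr// /c; lra.
  move=> p0; rewrite pmulr_lle0// pmulr_lle0 ?invr_gt0// => b0.
  by apply/eqP; rewrite -sqrf_eq0 eq_le b0 sqr_ge0.
have h1 := re _ Kr; have h2 := re _ (subspaceZ sK 'i Kr).
move: h1 h2; rewrite /rdot /= !dotZr.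
case: (dot _ _) => a b; case: (dot _ _) => a' b' /= h1 h2.
apply/eqP; rewrite eq_complex /=; apply/andP; split; apply/eqP; first by [].
by move: h2; rewrite !mul0r !mulN1r; lra.
Qed.

Lemma subspace_closure (X : set (H * H)) : subspace X -> subspace (closure X).
Proof.
move=> sX; split; first by apply: subset_closure; exact: sX.1.
move=> a [u1 u2] [v1 v2] /closure_pairP cu /closure_pairP cv.
apply/closure_pairP => e e0.
pose c := normc a + 1.
have a0 := normc_ge0 a.
have c0 : 0 < c by rewrite ltr_wpDl.
have key A B : A < e / c -> B < e / c -> normc a * A + B < e.
  move=> hA hB; have -> : e = normc a * (e / c) + e / c.
    by rewrite /c; field; rewrite gt_eqF.
  by rewrite ler_ltD// ler_wpM2l// ltW.
have [p1 [p2 [Xp h1 h2]]] := cu (e / c) (divr_gt0 e0 c0).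
have [q1 [q2 [Xq k1 k2]]] := cv (e / c) (divr_gt0 e0 c0).
have step s s' t t' : rnorm (s - s') < e / c -> rnorm (t - t') < e / c ->
    rnorm (a *: s + t - (a *: s' + t')) < e.
  move=> hs ht; rewrite opprD addrACA -scalerBr.
  by apply: le_lt_trans (rnormD _ _) _; rewrite rnormZ; exact: key.
exists (a *: p1 + q1), (a *: p2 + q2); split; try exact: step.
exact: (sX.2 a (p1, p2) (q1, q2)).
Qed.

Lemma dot_flip x y a b : dot x a = dot y b -> dot a x = dot b y.
Proof. by move=> e; rewrite dotC e -dotC. Qed.

(** The converse of [closure_annihilator]: the difference between (x, y) and its
    projection on the closure of X annihilates X, hence by assumption (x, y),
    hence itself. *)
Lemma closure_biorthogonal (X : set (H * H)) x y : subspace X ->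
  (forall a b, (forall u v, X (u, v) -> dot u a = dot v b) ->
     dot x a = dot y b) ->
  closure X (x, y).
Proof.
move=> sX h.
have [[c d] Xcd ort] := orthogonal_projection (x, y) (@closed_closure _ X)
  (subspace_closure sX).
have perp u v : X (u, v) -> dot u (x - c) = dot v (- (y - d)).
  move=> /(@subset_closure _ X)/ort /= /eqP; rewrite addr_eq0 => /eqP e.
  by rewrite dotNr; apply: (can_inj (@conjcK _)); rewrite raddfN/= -!dotC.
have e1 := h _ _ perp; have e2 := closure_annihilator Xcd perp.
have /eqP : dot (x - c) (x - c) + dot (y - d) (y - d) = 0.
  have -> : dot (x - c) (x - c) = dot (y - d) (- (y - d)).
    by rewrite dotBl e1 e2 -dotBl.
  by rewrite dotNr addNr.
rewrite !dotxx -rmorphD => /eqP/complexI/eqP.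
rewrite paddr_eq0 ?sqr_ge0// !sqrf_eq0.
move=> /andP[/eqP/rnorm_eq0/eqP + /eqP/rnorm_eq0/eqP].
by rewrite !subr_eq0 => /eqP -> /eqP ->.
Qed.

(** The orthogonality criterion in H is the one in H * H for the relation of all
    pairs whose first component lies in M. *)
Lemma denseP (M : set H) : subspace M ->
  closure M = setT <-> forall a, (forall x, M x -> dot x a = 0) -> a = 0.
Proof.
move=> sM; split=> [dM a ha|h].
  apply: dot_eq0; rewrite -(dot0l 0).
  apply: (@closure_annihilator [set p | M p.1]) => [|u v /= /ha ->].
    apply/closure_pairP => e e0.
    have /closureP/(_ e e0)[b Mb ab] : closure M a by rewrite dM.
    by exists b, 0; rewrite subr0 rnorm0.
  by rewrite dot0r.
apply/seteqP; split=> // x _; apply/closureP => e e0.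
have /closure_pairP/(_ e e0) : closure [set p | M p.1] (x, 0 : H).
  apply: closure_biorthogonal => [|a b hab].
    by split=> [|a [u1 u2] [v1 v2] /=]; [exact: sM.1 | exact: sM.2].
  rewrite (h a) ?dot0l ?dot0r// => u Mu.
  by rewrite (hab u 0)//= dot0l.
by move=> [a [b [/= Ma xa _]]]; exists a.
Qed.

(** If L2 is dominated by L1, the second components of L2 converge along every
    sequence on which those of L1 do. The last clause transports linear
    identities between the two components to the limits. *)
Lemma transfer (L1 L2 : set (H * H)) (c : R) x y : 0 <= c ->
  subspace L1 -> subspace L2 -> L1.`1 `<=` L2.`1 ->
  (forall u v w, L1 (u, v) -> L2 (u, w) -> rnorm w <= c * rnorm v) ->
  closure L1 (x, y) ->
  exists z, [/\ closure L2 (x, z), rnorm z <= c * rnorm y &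
    forall a b, (forall u v w, L1 (u, v) -> L2 (u, w) -> dot w a = dot v b) ->
      dot z a = dot y b].
Proof.
move=> c0 s1 s2 d12 bnd /closure_pairP cl.
have /choice [t ht] : forall n : nat, exists t : H * H * H,
   [/\ L1 t.1, L2 (t.1.1, t.2), rnorm (x - t.1.1) < n.+1%:R^-1
      & rnorm (y - t.1.2) < n.+1%:R^-1].
  move=> n; have [|u [v [Luv xu yv]]] := cl n.+1%:R^-1.
    by rewrite invr_gt0 ltr0n.
  have [|w Lw] := d12 u; first by exists v.
  by exists (u, v, w).
pose c' := c + 1.
have c'0 : 0 < c' by rewrite ltr_wpDl.
have bnd' u v w : L1 (u, v) -> L2 (u, w) -> rnorm w <= c' * rnorm v.
  move=> Lv Lw; apply: le_trans (bnd _ _ _ Lv Lw) _.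
  by rewrite ler_wpM2r ?rnorm_ge0// /c' lerDl.
have diff n m : rnorm ((t n).2 - (t m).2) <= c' * rnorm ((t n).1.2 - (t m).1.2).
  have [a1 a2 _ _] := ht n; have [b1 b2 _ _] := ht m.
  apply: (bnd' ((t n).1.1 - (t m).1.1)).
    by have := subspaceB s1 a1 b1; case: (t n).1 => ? ?; case: (t m).1.
  by have := subspaceB s2 a2 b2.
have [|z hz] := @cauchy_seq_cvg (fun n => (t n).2).
  move=> e e0; have [|N hN] := @inv_succ_small (e / (2 * c')).
    by rewrite divr_gt0// mulr_gt0.
  exists N => n m /hN n1 /hN m1; apply: le_lt_trans (diff n m) _.
  have [_ _ _ yn] := ht n; have [_ _ _ ym] := ht m.
  rewrite mulrC -ltr_pdivlMr//; apply: le_lt_trans (rnorm_triangle _ y _) _.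
  rewrite rnormBC; have -> : e / c' = e / (2 * c') + e / (2 * c').
    by field; rewrite gt_eqF.
  by apply: ltrD; [exact: lt_trans yn n1 | exact: lt_trans ym m1].
have cz (e : R) : 0 < e -> exists u v w, [/\ L1 (u, v), L2 (u, w),
    rnorm (x - u) < e, rnorm (y - v) < e & rnorm (z - w) < e].
  move=> e0; have [N hN] := inv_succ_small e0; have [M hM] := hz e e0.
  have [a1 a2 xn yn] := ht (maxn N M); have nN := hN _ (leq_maxl N M).
  exists (t (maxn N M)).1.1, (t (maxn N M)).1.2, (t (maxn N M)).2; split => //.
  - by case: (t _).1 a1.
  - exact: lt_trans xn nN.
  - exact: lt_trans yn nN.
  - by rewrite rnormBC hM ?leq_maxr.
exists z; split.
- apply/closure_pairP => e /cz[u [v [w [_ Lw xu _ zw]]]].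
  by exists u, w.
- apply/ler_addgt0Pr => e e0.
  have [|u [v [w [Lv Lw _ yv zw]]]] := cz (e / (c' + 1)).
    by rewrite divr_gt0// ltr_wpDl// ltW.
  have h1 := rnorm_triangle z w 0; have h2 := rnorm_triangle v y 0.
  have h3 : c * rnorm v <= c * (e / (c' + 1) + rnorm y).
    by rewrite ler_wpM2l//; move: h2 yv; rewrite (rnormBC v y) !subr0; lra.
  have h4 := bnd _ _ _ Lv Lw; rewrite !subr0 in h1.
  have -> : e = e / (c' + 1) + c * (e / (c' + 1)) + e / (c' + 1).
    by rewrite /c'; field; rewrite gt_eqF//; move: c'0; rewrite /c'; lra.
  have : 0 < e / (c' + 1) by rewrite divr_gt0// ltr_wpDl// ltW.
  by move: (e / _) zw h3 => f; rewrite mulrDr; lra.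
- move=> a b hab; apply/esym.
  apply: (@closure_annihilator [set p | exists u, L1 (u, p.1) /\ L2 (u, p.2)]).
    apply/closure_pairP => e /cz[u [v [w [Lv Lw _ yv zw]]]].
    by exists v, w; split => //; exists u.
  by move=> v w [u [Lv Lw]]; apply/esym; exact: hab Lv Lw.
Qed.

(** * Adjoints of linear relations *)

Local Notation adj := (adjoint dot).

Implicit Types X Y L Q : set (H * H).

Lemma subspace_op (X : set (H * H)) : is_operator X -> subspace X.
Proof. by case. Qed.

Lemma subspace_dom (X : set (H * H)) : subspace X -> subspace X.`1.
Proof.
move=> sX; split; first by exists 0; exact: sX.1.
move=> a u v [u' Xu] [v' Xv]; exists (a *: u' + v').
exact: (sX.2 a (u, u') (v, v')).
Qed.

Lemma subspace_ran (X : set (H * H)) : subspace X -> subspace X.`2.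
Proof.
move=> sX; split; first by exists 0; exact: sX.1.
move=> a u v [u' Xu] [v' Xv]; exists (a *: u' + v').
exact: (sX.2 a (u', u) (v', v)).
Qed.

Lemma subspace_mul (X Y : set (H * H)) : subspace X -> subspace Y ->
  subspace (op_mul X Y).
Proof.
move=> sX sY; split; first by exists 0; [exact: sY.1 | exact: sX.1].
move=> a [u1 u2] [v1 v2] [z /= Yz Xz] [w /= Yw Xw]; exists (a *: z + w).
  exact: (sY.2 a (u1, z) (v1, w)).
exact: (sX.2 a (z, u2) (w, v2)).
Qed.

Lemma subspace_restrict (X : set (H * H)) D : subspace X -> subspace D ->
  subspace (restrict_op X D).
Proof.
move=> sX sD; split; first by split; [exact: sX.1 | exact: sD.1].
by move=> a u v [Xu Du] [Xv Dv]; split; [exact: sX.2 | exact: sD.2].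
Qed.

Lemma subspace_adjoint X : subspace (adj X).
Proof.
split; first by move=> u v _ /=; rewrite !dot0r.
move=> a [u1 u2] [v1 v2] hu hv p q Xpq /=.
by rewrite !dotDr !dotZr (hu _ _ Xpq) (hv _ _ Xpq).
Qed.

Lemma closure_adjoint X : closure (adj X) `<=` adj X.
Proof.
move=> [x y] cxy u v Xuv /=; apply: dot_flip.
by apply: (closure_annihilator cxy) => p q h; apply: dot_flip; exact: h.
Qed.

Lemma closed_adjoint X : closed (adj X).
Proof.
apply/closure_id/seteqP.
by split; [exact: subset_closure | exact: closure_adjoint].
Qed.

Lemma adjoint_closure X : adj (closure X) = adj X.
Proof.
apply/seteqP; split=> -[x y] h u v Xuv.
  by apply: h; exact: subset_closure.
apply/esym; apply: (closure_annihilator Xuv) => p q /h /esym; exact.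
Qed.

Lemma adjointK X : subspace X -> adj (adj X) = closure X.
Proof.
move=> sX; apply/seteqP; split=> -[x y] h.
  apply: closure_biorthogonal => // a b hab.
  apply: dot_flip; apply: (h b a) => u v Xuv /=; exact/esym/hab.
move=> u v /= huv; apply: dot_flip; apply: (closure_annihilator h).
by move=> p q Xpq; apply/esym/huv.
Qed.

Lemma adjoint_inj0 X : subspace X -> densely_defined X -> forall z,
  adj X (0, z) -> z = 0.
Proof.
move=> sX dX z hz; apply: (denseP (subspace_dom sX)).1 => // x [y Xxy].
by have := hz _ _ Xxy; rewrite /= dot0r.
Qed.

(** If (a, b) is in adj D, solve x + D x = a + b; the difference a - x is then
    orthogonal to the range of 1 + D, which is everything. *)
Lemma nonneg_selfadjoint_of_surj (D : set (H * H)) :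
  is_operator D ->
  (forall x y x' y', D (x, y) -> D (x', y') -> dot y x' = dot x y') ->
  (forall x y, D (x, y) -> 0 <= dot y x) ->
  (forall h, exists x, D (x, h - x)) ->
  nonneg_selfadjoint dot D.
Proof.
move=> oD symD posD surD; have sD := subspace_op oD.
split=> //; split=> //.
  apply/(denseP (subspace_dom sD)) => a ha.
  have [x Dx] := surD a.
  have x0 : x = 0.
    have := posD _ _ Dx; rewrite dotBl (@dot_flip x 0 a 0) ?dot0l; last first.
      by rewrite ha //; exists (a - x).
    rewrite sub0r oppr_ge0 dotxx -[0]/(0%:C) lecR => x0.
    by apply: rnorm_eq0; apply/eqP; rewrite -sqrf_eq0 eq_le x0 sqr_ge0.
  case: oD => D0 _ opD.
  by rewrite x0 subr0 in Dx; apply: (opD 0 a 0 Dx).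
apply/seteqP; split=> -[a b] h; last first.
  by move=> u v Duv; apply: symD.
have [x Dx] := surD (a + b).
have perp u v : D (u, v) -> dot (u + v) (a - x) = 0.
  move=> Duv; have := h _ _ Duv; have := symD _ _ _ _ Duv Dx.
  by rewrite /= dotDl !dotBr dotDr => -> ->; ring.
have ax : a = x.
  have [z Dz] := surD (a - x).
  apply: subr0_eq; apply: dot_eq0.
  by have := perp _ _ Dz; rewrite addrC subrK.
by move: Dx; rewrite -ax addrAC subrr add0r.
Qed.

(** 1 + (adj X) X is onto: project (h, 0) on the graph X. *)
Lemma mul_adjoint_surj X : subspace X -> closed X -> forall h,
  exists x y, X (x, y) /\ adj X (y, h - x).
Proof.
move=> sX cX h.
have [[x y] Xxy ort] := orthogonal_projection (h, 0) cX sX.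
exists x, y; split=> // u v Xuv /=.
have := ort _ Xuv => /= /eqP; rewrite sub0r dotNl subr_eq0 => /eqP e.
exact/dot_flip/esym.
Qed.

(** The product is an operator even if X is multivalued: two intermediate values
    differ by an element y with X (0, y) and y in the domain of adj X, so that
    <y, y> = 0. *)
Lemma von_neumann X : subspace X -> closed X -> densely_defined X ->
  nonneg_selfadjoint dot (op_mul (adj X) X).
Proof.
move=> sX cX dX; apply: nonneg_selfadjoint_of_surj.
- have [h0 hl] := subspace_mul (@subspace_adjoint X) sX.
  split=> // x y z [y1 /= Xy Ay] [z1 /= Xz Az].
  have yz : y1 = z1.
    apply: subr0_eq; apply: dot_eq0.
    have X0 : X (0, y1 - z1) by rewrite -(subrr x); exact: (subspaceB sX Xy Xz).
    have := subspaceB (@subspace_adjoint X) Ay Az.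
    by move=> /(_ _ _ X0) /=; rewrite dot0l.
  apply: subr0_eq; apply: (adjoint_inj0 sX dX).
  have := subspaceB (@subspace_adjoint X) Ay Az.
  by rewrite yz; congr (adj X (_, _)); rewrite /= subrr.
- move=> x y x' y' [w /= Xw Aw] [w' /= Xw' Aw'].
  by have /= <- := Aw' _ _ Xw; apply: dot_flip; apply/esym; exact: (Aw _ _ Xw').
- move=> x y [w /= Xw Aw].
  have /dot_flip /= <- := Aw _ _ Xw.
  by rewrite dotxx ler0c sqr_ge0.
- move=> h; have [x [y [Xxy Ay]]] := mul_adjoint_surj sX cX h.
  by exists x; exists y.
Qed.

(** An element of the graph of L orthogonal to X vanishes, so X is dense in L;
    for an operator it is enough that the first component vanishes. *)
Lemma core_criterion L X :
  is_operator L -> closed L -> subspace X -> X `<=` L ->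
  (forall p q, L (p, q) -> (forall u v, X (u, v) -> dot u p + dot v q = 0) ->
     p = 0) ->
  L `<=` closure X.
Proof.
move=> oL cL sX XL h [x y] Lxy; apply: closure_biorthogonal => // a b hab.
have [[p q] Lpq ort] := orthogonal_projection (a, - b) cL (subspace_op oL).
have {}ort u v : L (u, v) -> dot u p + dot v q = dot u a - dot v b.
  move=> /ort /= /eqP; rewrite -opprD dotNl subr_eq0 => /eqP/dot_flip.
  rewrite dotBr dotDr => e.
  by rewrite -[dot u a](subrK (dot u p)) e; ring.
have p0 : p = 0.
  apply: (h _ _ Lpq) => u v Xuv; rewrite ort; last exact: XL.
  by rewrite (hab _ _ Xuv) subrr.
have q0 : q = 0.
  by case: oL => L0 _ /(_ 0 q 0) opL; apply: opL => //; rewrite -p0.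
have := ort _ _ Lxy; rewrite p0 q0 !dot0r addr0 => /esym/eqP.
by rewrite subr_eq0 => /eqP.
Qed.

(** If (p, L p) is orthogonal to the graph of the restriction, then p is
    orthogonal to the range of 1 + (adj L) L. *)
Lemma core_mul_adjoint L : is_operator L -> closed L ->
  L `<=` closure (restrict_op L (op_mul (adj L) L).`1).
Proof.
move=> oL cL; have sL := subspace_op oL; apply: core_criterion => //.
- apply: subspace_restrict => //; apply: subspace_dom.
  apply: subspace_mul => //.
  exact: subspace_adjoint.
- by move=> p [].
move=> p q Lpq h; have [u [v [Luv Av]]] := mul_adjoint_surj sL cL p.
apply: dot_eq0; rewrite -(h u v); last by split=> //; exists (p - u); exists v.
have /dot_flip /= -> := Av _ _ Lpq.
by rewrite -dotDl addrC subrK.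
Qed.

Lemma selfadjoint_closed L : selfadjoint dot L -> closed_operator L.
Proof. by move=> [oL _ e]; split=> //; rewrite -e; exact: closed_adjoint. Qed.

Lemma selfadjoint_subspace L : selfadjoint dot L -> subspace L.
Proof. by case=> /subspace_op. Qed.

(** * Resolvents and square roots *)

Lemma nonneg_rdot x y : 0 <= dot y x -> 0 <= rdot x y.
Proof. by rewrite lecE /= rdotC => /andP[]. Qed.

(** For y = S x with S nonnegative this says that (1 + S)^{-1} and
    S (1 + S)^{-1} are contractions. *)
Lemma resolvent_bound x y : 0 <= dot y x ->
  rnorm x <= rnorm (x + y) /\ rnorm y <= rnorm (x + y).
Proof.
move=> /nonneg_rdot h; have := sqr_rnormD x y => e.
by split; rewrite -(@ler_pXn2r _ 2) ?nnegrE ?rnorm_ge0// e;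
  have := sqr_ge0 (rnorm x); have := sqr_ge0 (rnorm y); rewrite mulr2n; lra.
Qed.

(** 1 + S has dense range since S is selfadjoint and nonnegative, and its
    inverse is a contraction, so [transfer] extends it to the whole space. *)
Lemma resolvent (S : set (H * H)) : nonneg_selfadjoint dot S ->
  forall h, exists x, S (x, h - x).
Proof.
move=> [[oS dS saS] posS] h; have sS := subspace_op oS.
pose E := [set k | exists x, S (x, k - x)].
pose L1 := [set p : H * H | E p.1 /\ p.1 = p.2].
pose L2 := [set p : H * H | S (p.2, p.1 - p.2)].
have lin a (u v x z : H) : a *: (u - x) + (v - z) = a *: u + v - (a *: x + z).
  by rewrite scalerBr opprD addrACA.
have sE : subspace E.
  split; first by exists 0; rewrite subr0; exact: sS.1.
  move=> a u v [x Sx] [z Sz]; exists (a *: x + z).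
  by rewrite -lin; exact: (sS.2 a (x, u - x) (z, v - z)).
have s1 : subspace L1.
  split; first by split => //; exact: sE.1.
  by move=> a [u u'] [v v'] [/= Eu <-] [/= Ev <-]; split => //=; exact: sE.2.
have s2 : subspace L2.
  split; first by rewrite /L2 /= subr0; exact: sS.1.
  move=> a [u x] [v z] /= Sx Sz; rewrite /L2 /= -lin.
  exact: (sS.2 a (x, u - x) (z, v - z)).
have dE : closure E = setT.
  apply/(denseP sE) => a ha.
  have Sa : S (a, - a).
    rewrite -saS => u v Suv /=; rewrite dotNr; apply/eqP.
    rewrite -addr_eq0 -dotDl.
    by apply/eqP/ha; exists u; rewrite addrK.
  have [] := resolvent_bound (posS _ _ Sa); rewrite subrr rnorm0 => a0 _.
  exact: rnorm_le0.
have [|||x [cx _ _]] := @transfer L1 L2 1 h h ler01 s1 s2.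
- by move=> u [v [/= [x Sx] _]]; exists x.
- move=> u v w [_ /= <-] /= /posS/resolvent_bound[]; rewrite addrC subrK mul1r.
  by [].
- apply/closure_pairP => e e0.
  have /closureP/(_ e e0)[k Ek hk] : closure E h by rewrite dE.
  by exists k, k.
exists x; rewrite -saS => u v Suv /=.
have : dot h u = dot x (u + v).
  apply: (closure_annihilator cx) => p q /= Sqp.
  have : adj S (q, p - q) by rewrite saS.
  move=> /(_ _ _ Suv)/dot_flip /= e.
  by rewrite dotDr e dotBl addrC subrK.
rewrite dotDr => e; apply: dot_flip.
by rewrite dotBl e addrC addKr.
Qed.

Definition symmetric_fun (f : H -> H) := forall x y, dot (f x) y = dot x (f y).
Definition contraction_fun (f : H -> H) := forall x, rnorm (f x) <= rnorm x.

Lemma dot_ext x y : (forall z, dot x z = dot y z) -> x = y.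
Proof.
move=> h; apply: subr0_eq; apply: dot_eq0.
by rewrite dotBl h subrr.
Qed.

(** An everywhere defined function with an adjoint is linear. *)
Section AdjointFun.
Variables g g' : H -> H.
Hypothesis gg' : forall x y, dot (g x) y = dot x (g' y).

Lemma adjoint_funP a x y : g' (a *: x + y) = a *: g' x + g' y.
Proof.
apply: dot_ext => z; apply: dot_flip.
by rewrite dotDr dotZr -!gg' dotDr dotZr.
Qed.
Lemma adjoint_fun0 : g' 0 = 0.
Proof. by apply: dot_ext => z; apply: dot_flip; rewrite -gg' !dot0r. Qed.
Lemma adjoint_funZ a x : g' (a *: x) = a *: g' x.
Proof. by rewrite -[a *: x]addr0 adjoint_funP adjoint_fun0 addr0. Qed.
Lemma adjoint_funD x y : g' (x + y) = g' x + g' y.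
Proof. by rewrite -[x]scale1r adjoint_funP !scale1r. Qed.
Lemma adjoint_funB x y : g' (x - y) = g' x - g' y.
Proof. by rewrite adjoint_funD -scaleN1r adjoint_funZ scaleN1r. Qed.
End AdjointFun.

Lemma seq_cvg_unique (u : nat -> H) l m : seq_cvg u l -> seq_cvg u m -> l = m.
Proof.
move=> ul um; apply/subr0_eq/rnorm_le0.
apply/ler_addgt0Pr => e e0; rewrite add0r.
have e2 : 0 < e / 2 by rewrite divr_gt0.
have [N hN] := ul _ e2; have [M hM] := um _ e2.
have := hN (maxn N M) (leq_maxl _ _); have := hM (maxn N M) (leq_maxr _ _).
have := rnorm_triangle l (u (maxn N M)) m; rewrite (rnormBC l (u _)); lra.
Qed.

(** The fixed point Y of Y = (Z + Y^2) / 2 satisfies (1 - Y)^2 = 1 - Z. The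
    iteration converges because its increments are dominated by those of the
    same iteration started with the number 1 in place of Z, a bounded monotone
    sequence. *)
Section SqrtIteration.
Variable Z : H -> H.
Hypotheses (sZ : symmetric_fun Z) (cZ : contraction_fun Z).

Fixpoint sqrt_iter n x : H :=
  if n is m.+1 then (2^-1 : R)%:C *: (Z x + sqrt_iter m (sqrt_iter m x)) else 0.

Fixpoint scalar_iter n : R :=
  if n is m.+1 then (1 + scalar_iter m ^+ 2) / 2 else 0.

Local Notation Y := sqrt_iter.
Local Notation y := scalar_iter.

Lemma sqrt_iter_sym n : symmetric_fun (Y n).
Proof.
elim: n => [|n IH] u v /=; first by rewrite dot0l dot0r.
by rewrite dotZl dotZrR dotDl dotDr sZ !IH.
Qed.

Lemma sqrt_iter_comm (C : H -> H) : symmetric_fun C ->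
  (forall x, C (Z x) = Z (C x)) -> forall n x, C (Y n x) = Y n (C x).
Proof.
move=> sC CZ; elim=> [|n IH] x /=; first exact: adjoint_fun0.
by rewrite (adjoint_funZ sC) (adjoint_funD sC) CZ !IH.
Qed.

Lemma sqrt_iterC n m x : Y n (Y m x) = Y m (Y n x).
Proof.
apply: sqrt_iter_comm => [|u]; first exact: sqrt_iter_sym.
by apply/esym; exact: sqrt_iter_comm.
Qed.

Lemma scalar_iter_bound n : 0 <= y n <= 1.
Proof.
elim: n => [|n /andP[h0 h1]] /=; first by rewrite lexx ler01.
have h2 : y n ^+ 2 <= 1 by rewrite expr_le1.
have h3 := sqr_ge0 (y n); apply/andP; split; lra.
Qed.

Lemma rnorm_half x : rnorm ((2^-1 : R)%:C *: x) = rnorm x / 2.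
Proof.
by rewrite rnormZ /= expr0n /= addr0 sqrtr_sqr ger0_norm ?invr_ge0// mulrC.
Qed.

Lemma sqrt_iter_bound n x : rnorm (Y n x) <= y n * rnorm x.
Proof.
elim: n x => [|n IH] x /=; first by rewrite rnorm0 mul0r.
rewrite rnorm_half; have := rnormD (Z x) (Y n (Y n x)); have := cZ x.
have /andP[y0 _] := scalar_iter_bound n.
have := ler_wpM2l y0 (IH x); have := IH (Y n x); rewrite expr2; lra.
Qed.

Lemma scalar_iter_le n : y n <= y n.+1.
Proof. by rewrite /=; have := sqr_ge0 (1 - y n); rewrite sqrrB; lra. Qed.

(** Consecutive iterates commute, so the difference of their squares factors as
    in the scalar case. *)
Lemma sqrt_iter_step n x : rnorm (Y n.+1 x - Y n x) <= (y n.+1 - y n) * rnorm x.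
Proof.
elim: n x => [|n IH] x.
  by rewrite /= !subr0 addr0 rnorm_half expr0n /= addr0; have := cZ x; lra.
set A := Y n.+1 in IH *; set a := y n.+1 in IH *.
have -> : Y n.+2 x - A x =
          (2^-1 : R)%:C *: (A (A x + Y n x) - Y n (A x + Y n x)).
  have sA : symmetric_fun A by exact: sqrt_iter_sym n.+1.
  have -> : Y n.+2 x - A x = (2^-1 : R)%:C *: (Z x + A (A x)) -
                             (2^-1 : R)%:C *: (Z x + Y n (Y n x)) by [].
  rewrite (adjoint_funD sA) (adjoint_funD (sqrt_iter_sym n)) -scalerBr.
  congr (_ *: _).
  have -> : Y n (A x) = A (Y n x) by exact: sqrt_iterC.
  by rewrite opprD addrACA subrr add0r opprD addrA addrK.
have -> : y n.+2 - a = (a - y n) * (a + y n) / 2.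
  have Ea : a = (1 + y n ^+ 2) / 2 by [].
  have -> : y n.+2 = (1 + a ^+ 2) / 2 by [].
  by rewrite {2}Ea; clearbody a; field.
rewrite rnorm_half.
have /andP[a0 _] := scalar_iter_bound n.+1.
have /andP[b0 _] := scalar_iter_bound n.
rewrite mulrAC ler_pM2r ?invr_gt0// -mulrA.
have h := IH (A x + Y n x); apply: le_trans h _.
rewrite ler_wpM2l//.
  by rewrite subr_ge0 scalar_iter_le.
apply: le_trans (rnormD _ _) _.
by rewrite mulrDl lerD//; exact: sqrt_iter_bound.
Qed.

Lemma scalar_iter_mono n m : (n <= m)%N -> y n <= y m.
Proof.
move=> /subnKC <-; elim: (m - n)%N => [|k IH]; first by rewrite addn0.
by rewrite addnS (le_trans IH)// scalar_iter_le.
Qed.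

Lemma sqrt_iter_dist n m x : (n <= m)%N ->
  rnorm (Y m x - Y n x) <= (y m - y n) * rnorm x.
Proof.
move=> /subnKC <-; elim: (m - n)%N => [|k IH].
  by rewrite addn0 !subrr rnorm0 mul0r.
rewrite addnS; apply: le_trans (rnorm_triangle _ (Y (n + k) x) _) _.
have := sqrt_iter_step (n + k) x.
by move: (y (n + k).+1) IH => a; lra.
Qed.

Lemma sqrt_iter_cvg x : exists l, seq_cvg (fun n => Y n x) l.
Proof.
apply: cauchy_seq_cvg => e e0.
pose s := sup (range y).
have hs : has_sup (range y).
  split; first by exists (y 0%N), 0%N.
  by exists 1 => _ [n _ <-]; have /andP[] := scalar_iter_bound n.
have ys n : y n <= s by apply: ub_le_sup; [exact: hs.2 | exists n].
have c0 : 0 < rnorm x + 1 by rewrite ltr_wpDl// rnorm_ge0.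
have d0 : 0 < e / (rnorm x + 1) by rewrite divr_gt0.
have [_ [N _ <-] hN] := sup_adherent d0 hs.
exists N => n m.
wlog mn : n m / (m <= n)%N.
  move=> wl nN mN; have [mn|/ltnW nm] := leqP m n; first exact: wl.
  by rewrite rnormBC; exact: wl.
move=> nN mN; apply: le_lt_trans (sqrt_iter_dist _ mn) _.
have h : y n - y m < e / (rnorm x + 1).
  by have := ys n; have := scalar_iter_mono mN; move: hN; rewrite -/s; lra.
apply: le_lt_trans (_ : e / (rnorm x + 1) * rnorm x < e).
  by rewrite ler_wpM2r ?rnorm_ge0// ltW.
by rewrite mulrAC ltr_pdivrMr// ltr_pM2l// ltrDl.
Qed.

End SqrtIteration.

(** The root P = 1 - Y inherits the shape of the hypotheses on X, so that the
    construction can be applied to P again; this is how positivity of P is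
    obtained, as P = K^2 with K symmetric. *)
Lemma bounded_sqrt (X : H -> H) : symmetric_fun X ->
  contraction_fun (fun x => x - X x) ->
  exists P : H -> H, [/\ symmetric_fun P, contraction_fun (fun x => x - P x),
    forall x, P (P x) = X x &
    forall C, symmetric_fun C -> (forall x, C (X x) = X (C x)) ->
      forall x, C (P x) = P (C x)].
Proof.
move=> sX cX; pose Z x := x - X x.
have sZ : symmetric_fun Z by move=> x y; rewrite dotBl dotBr sX.
have /choice [Y hY] := sqrt_iter_cvg sZ cX.
pose Yn := sqrt_iter Z.
have sY : symmetric_fun Y.
  move=> x y; apply: subr0_eq.
  apply: (@normc_small _ (rnorm y + rnorm x)) => [|e e0].
    by rewrite addr_ge0// rnorm_ge0.
  have [N hN] := hY x e e0; have [M hM] := hY y e e0.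
  pose n := maxn N M.
  have -> : dot (Y x) y - dot x (Y y) =
            dot (Y x - Yn n x) y - dot x (Y y - Yn n y).
    by rewrite dotBl dotBr (sqrt_iter_sym sZ n x y); ring.
  have := hN n (leq_maxl _ _); have := hM n (leq_maxr _ _).
  rewrite rnormBC => h1; rewrite rnormBC => h2.
  apply: le_trans (normc_dotB _ _ _ _) _.
  rewrite mulrDr lerD// ?(mulrC _ (rnorm x)).
    by rewrite ler_wpM2r ?rnorm_ge0// ltW.
  by rewrite ler_wpM2l ?rnorm_ge0// ltW.
have cYn n x : rnorm (Yn n x) <= rnorm x.
  apply: le_trans (sqrt_iter_bound cX n x) _.
  by rewrite ler_piMl ?rnorm_ge0//; have /andP[] := scalar_iter_bound n.
have cY : contraction_fun Y.
  move=> x; apply/ler_addgt0Pr => e e0; have [N hN] := hY x e e0.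
  have := hN N (leqnn _); have := cYn N x.
  have := rnorm_triangle (Y x) (Yn N x) 0.
  by rewrite !subr0 rnormBC -/(Yn N x); lra.
have fixY x : Y x + Y x = Z x + Y (Y x).
  have lim1 : seq_cvg (fun n => Yn n.+1 x) (Y x).
    by move=> e /(hY x)[N hN]; exists N => n Nn; apply: hN; exact: leqW.
  have lim2 : seq_cvg (fun n => Yn n.+1 x) ((2^-1 : R)%:C *: (Z x + Y (Y x))).
    move=> e e0.
    have [N hN] := hY x e e0; have [M hM] := hY (Y x) e e0.
    exists (maxn N M) => n; rewrite geq_max => /andP[Nn Mn] /=.
    rewrite -scalerBr rnorm_half opprD addrACA subrr add0r.
    have h1 : rnorm (Yn n x - Y x) < e := hN _ Nn.
    have h2 : rnorm (Yn n (Y x) - Y (Y x)) < e := hM _ Mn.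
    have sYn : symmetric_fun (Yn n) := sqrt_iter_sym sZ n.
    rewrite -!/(Yn _ _).
    have := rnorm_triangle (Yn n (Yn n x)) (Yn n (Y x)) (Y (Y x)).
    have := cYn n (Yn n x - Y x).
    by rewrite (adjoint_funB sYn); lra.
  have e := seq_cvg_unique lim1 lim2.
  rewrite {1 2}e -scalerDl -rmorphD.
  have -> : 2^-1 + 2^-1 = 1 :> R by field.
  by rewrite scale1r.
exists (fun x => x - Y x); split.
- by move=> x y; rewrite dotBl dotBr sY.
- by move=> x; rewrite opprB addrC subrK; exact: cY.
- move=> x; rewrite (adjoint_funB sY).
  have -> : x - Y x - (Y x - Y (Y x)) = x + Y (Y x) - (Y x + Y x).
    by rewrite opprB opprD !addrA; rewrite [x - Y x + _]addrAC.
  by rewrite fixY opprD addrACA subrr addr0 /Z opprB addrC subrK.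
- move=> C sC CX x.
  have CZ u : C (Z u) = Z (C u) by rewrite /Z (adjoint_funB sC) CX.
  rewrite (adjoint_funB sC); congr (_ - _); apply: dot_ext => z; rewrite sC.
  apply: (@closure_annihilator [set p | exists n, p = (Yn n x, Yn n (C x))]).
    apply/closure_pairP => e e0.
    have [N hN] := hY x e e0; have [M hM] := hY (C x) e e0.
    exists (Yn (maxn N M) x), (Yn (maxn N M) (C x)); split.
    - by exists (maxn N M).
    - by rewrite rnormBC hN ?leq_maxl.
    - by rewrite rnormBC hM ?leq_maxr.
  by move=> u v [n [-> ->]]; rewrite -sC (sqrt_iter_comm sC CZ).
Qed.

Lemma resolvent_fun (S : set (H * H)) : nonneg_selfadjoint dot S ->
  exists r, symmetric_fun r /\ forall h, S (r h, h - r h).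
Proof.
move=> nS; have [r hr] := choice (resolvent nS); exists r; split=> // x y.
have : adj S (r y, y - r y) by have [[_ _ ->] _] := nS; exact: hr.
move=> /(_ _ _ (hr x)) /=; rewrite dotBl dotBr => e.
by apply: (addIr (- dot (r x) (r y))).
Qed.

(** Let r = (1 + S)^{-1}, P = r^{1/2} and N = (1 - r)^{1/2}; these commute and
    P^2 + N^2 = 1. Formally S = N^2 P^{-2}, which suggests Q = N P^{-1}, whose
    graph consists of the pairs (P u, N u). The identity P^2 + N^2 = 1 recovers
    the parameter of such a pair (x, y) as u = P x + N y. *)
Lemma nonneg_sqrt_exists (S : set (H * H)) : nonneg_selfadjoint dot S ->
  exists Q, nonneg_selfadjoint dot Q /\ op_mul Q Q = S.
Proof.
move=> nS; have [r [sr hr]] := resolvent_fun nS.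
have [[[S0 Slin opS] _ saS] posS] := nS.
have sS : subspace S by split.
have [P [sP cP PP PC]] : exists P, [/\ symmetric_fun P,
    contraction_fun (fun x => x - P x), forall x, P (P x) = r x &
    forall C, symmetric_fun C -> (forall x, C (r x) = r (C x)) ->
      forall x, C (P x) = P (C x)].
  apply: bounded_sqrt => // x.
  by have [_] := resolvent_bound (posS _ _ (hr x)); rewrite (addrC (r x)) subrK.
pose r' x := x - r x.
have sr' : symmetric_fun r' by move=> x y; rewrite dotBl dotBr sr.
have [N [sN cN NN NC]] : exists N, [/\ symmetric_fun N,
    contraction_fun (fun x => x - N x), forall x, N (N x) = r' x &
    forall C, symmetric_fun C -> (forall x, C (r' x) = r' (C x)) ->
      forall x, C (N x) = N (C x)].
  apply: bounded_sqrt => // x; rewrite opprB addrC subrK.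
  by have [] := resolvent_bound (posS _ _ (hr x)); rewrite (addrC (r x)) subrK.
have PN x : P (N x) = N (P x).
  apply: NC => // {}x; rewrite /r' (adjoint_funB sP); congr (_ - _).
  by apply/esym; apply: PC.
have [K [sK _ KK KC]] := bounded_sqrt sP cP.
have [M [sM _ MM MC]] := bounded_sqrt sN cN.
have NK x : N (K x) = K (N x) by apply: KC => // {}x; rewrite PN.
have sq x : P (P x) + N (N x) = x by rewrite PP NN addrC subrK.
pose Q := [set p : H * H | exists u, p = (P u, N u)].
have QE x y : Q (x, y) <-> N x = P y.
  split=> [[u [-> ->]]|e]; first by rewrite PN.
  exists (P x + N y); congr (_, _).
    by rewrite (adjoint_funD sP) PN -e sq.
  by rewrite (adjoint_funD sN) -PN e sq.
have P0 x : P x = 0 -> x = 0.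
  move=> x0; have := hr x; rewrite -PP x0 (adjoint_fun0 sP) subr0 => Sx.
  exact: opS Sx S0.
have sQ : subspace Q.
  split; first by apply/QE; rewrite (adjoint_fun0 sN) (adjoint_fun0 sP).
  move=> a [u1 u2] [v1 v2] /QE hu /QE hv; apply/QE.
  by rewrite (adjoint_funP sN) (adjoint_funP sP) hu hv.
(* <N u, P u> = |M K u|^2 with K^2 = P and M^2 = N *)
have NP_ge0 u : 0 <= dot (N u) (P u).
  rewrite -KK -sK -NK -MM sM dotxx.
  by rewrite ler0c sqr_ge0.
have r_uniq x y : S (x, y) -> r (x + y) = x.
  move=> Sxy; have Sd := subspaceB sS (hr (x + y)) Sxy.
  have [] := resolvent_bound (posS _ _ Sd).
  have -> : x + y - r (x + y) - y = x - r (x + y) by rewrite addrAC addrK.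
  rewrite -(opprB (r (x + y)) x) subrr rnorm0 => h _.
  exact/subr0_eq/rnorm_le0.
exists Q; split; last first.
  apply/seteqP; split=> -[x y] /=.
    move=> [z [u [-> ->]] [v [e1 ->]]].
    pose w := P u + N v.
    have Pw : P w = u by rewrite /w (adjoint_funD sP) PN -e1 sq.
    have Nw : N w = v by rewrite /w (adjoint_funD sN) -PN e1 sq.
    by have := hr w; rewrite -/(r' w) -PP -NN Pw Nw.
  move=> Sxy; pose w := x + y.
  have wx : P (P w) = x by rewrite PP r_uniq.
  have wy : N (N w) = y by rewrite NN /r' r_uniq// /w addrC addKr.
  exists (P (N w)).
    by exists (P w); rewrite wx PN.
  by exists (N w); rewrite wy.
split; last first.
  by move=> x y [u [-> ->]].
split.
- have [h0 hl] := sQ; split=> // x y z /QE xy /QE xz.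
  apply/subr0_eq/P0.
  by rewrite (adjoint_funB sP) -xy xz subrr.
- apply/(denseP (subspace_dom sQ)) => a ha; apply: P0; apply: dot_eq0.
  rewrite -sP; apply: ha; exists (N (P a)); by exists (P a).
- apply/seteqP; split=> -[x y] h.
    apply/QE/dot_ext => z; apply: dot_flip; rewrite -sN -sP.
    by apply: (h (P z) (N z)); exists z.
  move=> _ _ [u [-> ->]] /=; rewrite sN sP.
  by move/QE: h => ->.
Qed.

Lemma op_sqrtP (D : set (H * H)) : nonneg_selfadjoint dot D ->
  nonneg_selfadjoint dot (op_sqrt dot D) /\
  op_mul (op_sqrt dot D) (op_sqrt dot D) = D.
Proof.
by move=> nD; exact: (xgetPex set0 (nonneg_sqrt_exists nD)).
Qed.

(** On the common domain of the products both moduli are given by <D x, x>, and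
    this domain is a core of L1. *)
Lemma modulus_le L1 L2 : closed_operator L1 -> closed_operator L2 ->
  op_mul (adj L1) L1 = op_mul (adj L2) L2 ->
  forall x y, L1 (x, y) -> exists2 z, L2 (x, z) & rnorm z <= rnorm y.
Proof.
move=> [ o1 c1] [ o2 c2] e x y L1xy.
have s1 := subspace_op o1; have s2 := subspace_op o2.
have [| | |z [cz nz _]] := @transfer _ L2 1 x y ler01 _ s2 _ _
    (core_mul_adjoint o1 c1 L1xy).
- apply: subspace_restrict => //; apply: subspace_dom.
  apply: subspace_mul => //.
  exact: subspace_adjoint.
- by move=> u [v [_ [d /=]]]; rewrite e => -[w L2uw _]; exists w.
- move=> u v w [L1uv [d /= Dud]] L2uw; rewrite mul1r.
  rewrite -(@ler_pXn2r _ 2) ?nnegrE ?rnorm_ge0// -lecR -!dotxx.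
  have [v' /= L1uv' /(_ _ _ L1uv) /=] := Dud.
  have [_ _ op1] := o1; rewrite (op1 _ _ _ L1uv' L1uv) => ->.
  move: Dud; rewrite e => -[w' /= L2uw' /(_ _ _ L2uw) /=].
  by have [_ _ op2] := o2; rewrite (op2 _ _ _ L2uw' L2uw) => ->.
- by exists z; [rewrite ((closure_id L2).1 c2) | rewrite -[leRHS]mul1r].
Qed.

Lemma sqrt_modulus L : closed_operator L ->
  nonneg_selfadjoint dot (op_mul (adj L) L) ->
  forall x, (forall y, L (x, y) ->
    exists2 z, op_sqrt dot (op_mul (adj L) L) (x, z) & rnorm z = rnorm y) /\
  (forall z, op_sqrt dot (op_mul (adj L) L) (x, z) ->
    exists2 y, L (x, y) & rnorm y = rnorm z).
Proof.
move=> cL nD x; have [[saQ _] QQ] := op_sqrtP nD.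
set Q := op_sqrt _ _ in saQ QQ *.
have cQ := selfadjoint_closed saQ; have [[_ _ opQ] _ adjQ] := saQ.
have e : op_mul (adj L) L = op_mul (adj Q) Q by rewrite adjQ QQ.
have [[_ _ opL] _] := cL.
split=> [y Lxy|z Qxz].
  have [z Qxz zy] := modulus_le cL cQ e Lxy; exists z => //.
  have [y' Lxy' yz] := modulus_le cQ cL (esym e) Qxz.
  by apply/eqP; rewrite eq_le zy (opL _ _ _ Lxy Lxy').
have [y Lxy yz] := modulus_le cQ cL (esym e) Qxz; exists y => //.
have [z' Qxz' zy] := modulus_le cL cQ e Lxy.
by apply/eqP; rewrite eq_le yz (opQ _ _ _ Qxz Qxz').
Qed.

(** * Bounded operators *)

Lemma closure_bound X c : 0 <= c ->
  (forall x y, X (x, y) -> rnorm y <= c * rnorm x) ->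
  forall x y, closure X (x, y) -> rnorm y <= c * rnorm x.
Proof.
move=> c0 h x y /closure_pairP cX; apply/ler_addgt0Pr => e e0.
have c1 : 0 < c + 1 by rewrite ltr_wpDl.
have [u [v [Xuv xu yv]]] := cX _ (divr_gt0 e0 c1).
have h1 := h _ _ Xuv.
have := rnorm_triangle y v 0; have := rnorm_triangle u x 0.
rewrite (rnormBC u x) !subr0 => h2 h3.
have h4 : c * rnorm u <= c * (e / (c + 1) + rnorm x).
  by rewrite ler_wpM2l//; lra.
have -> : e = c * (e / (c + 1)) + e / (c + 1) by field; rewrite gt_eqF.
by move: (e / _) yv h4 => f; rewrite mulrDr; lra.
Qed.

(** Apply [transfer] to the identity of the dense domain and X. *)
Lemma bounded_full_domain X c : closed_operator X -> densely_defined X ->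
  0 <= c -> (forall x y, X (x, y) -> rnorm y <= c * rnorm x) -> X.`1 = setT.
Proof.
move=> [ oX cX] dX c0 h; have sX := subspace_op oX.
apply/seteqP; split=> // x _.
pose L1 := [set p : H * H | X.`1 p.1 /\ p.1 = p.2].
have s1 : subspace L1.
  have sd := subspace_dom sX; split; first by split => //; exact: sd.1.
  by move=> a [u u'] [v v'] [/= Eu <-] [/= Ev <-]; split => //=; exact: sd.2.
have [|||z [cz _ _]] := @transfer L1 X c x x c0 s1 sX.
- by move=> u [v [Xu _]].
- by move=> u _ w [_ /= <-]; exact: h.
- apply/closure_pairP => e e0.
  have /closureP/(_ e e0)[u Xu xu] : closure X.`1 x by rewrite dX.
  by exists u, u.
- by exists z; rewrite ((closure_id X).1 cX).
Qed.

Definition graph (g : H -> H) : set (H * H) := [set p | p.2 = g p.1].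
Arguments graph g _ /.

Lemma adjoint_dense X : subspace X ->
  (forall z, closure X (0, z) -> z = 0) -> densely_defined (adj X).
Proof.
move=> sX h; apply/(denseP (subspace_dom (@subspace_adjoint X))) => a ha.
apply: h; rewrite -adjointK// => u v Auv /=; rewrite dot0r ha//.
by exists v.
Qed.

(** The adjoint is bounded by |y|^2 = <x, G y> <= c |x| |y| for y = adj G x, it
    is densely defined because the closure of G is an operator, and therefore
    it is defined everywhere. *)
Lemma bounded_operatorP G : bounded_operator G ->
  exists g g' c, [/\ G = graph g, 0 <= c, forall x, rnorm (g x) <= c * rnorm x,
    forall x, rnorm (g' x) <= c * rnorm x &
    forall x y, dot (g x) y = dot x (g' y)].
Proof.
move=> [ oG domG [c0 hc0]]; have sG := subspace_op oG; have [_ _ opG] := oG.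
have /choice [g hg] : forall x, exists y, G (x, y).
  by move=> x; have : [set: H] x by []; rewrite -domG.
have GE : G = graph g.
  apply/seteqP; split=> -[x y] /=; first by move=> Gxy; exact: opG Gxy (hg x).
  by rewrite /graph /= => ->.
pose c := `|c0|.
have bG x y : G (x, y) -> rnorm y <= c * rnorm x.
  move=> /hc0; rewrite !norm_rnorm -rmorphM/= lecR => /le_trans; apply.
  by rewrite ler_wpM2r ?rnorm_ge0// ler_norm.
have c_ge0 : 0 <= c by exact: normr_ge0.
have cG := closure_bound c_ge0 bG.
have dA : densely_defined (adj G).
  apply: adjoint_dense => // z /cG; rewrite rnorm0 mulr0 => z0.
  exact: rnorm_le0.
have bA x y : adj G (x, y) -> rnorm y <= c * rnorm x.
  move=> h; have := h _ _ (hg y) => /= e.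
  have [->|y0] := eqVneq (rnorm y) 0; first by rewrite mulr_ge0// rnorm_ge0.
  have y_gt0 : 0 < rnorm y by rewrite lt_neqAle eq_sym y0 rnorm_ge0.
  rewrite -(ler_pM2l y_gt0) -expr2 -rdotxx {1}/rdot -e -/(rdot _ _).
  apply: le_trans (rdot_le _ _) _; rewrite mulrA ler_wpM2r ?rnorm_ge0//.
  by rewrite mulrC; exact: bG (hg y).
have sA := @subspace_adjoint G.
have oA : is_operator (adj G).
  have [A0 lA] := sA; split=> // x y z Ay Az.
  have /bA := subspaceB sA Ay Az; rewrite /= subrr rnorm0 mulr0 => yz.
  exact/subr0_eq/rnorm_le0.
have domA := bounded_full_domain (conj oA (@closed_adjoint G)) dA c_ge0 bA.
have /choice [g' hg'] : forall x, exists y, adj G (x, y).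
  by move=> x; have : [set: H] x by []; rewrite -domA.
exists g, g', c; split=> // [x|x|x y].
- exact: bG (hg x).
- exact: bA (hg' x).
- exact: (hg' y _ _ (hg x)).
Qed.

(** * Factors of closed operators *)

Lemma selfadjoint_max X Y : selfadjoint dot X -> selfadjoint dot Y ->
  X `<=` Y -> X = Y.
Proof.
move=> [_ _ aX] [_ _ aY] XY; apply/seteqP; split=> // -[x y] Yxy.
rewrite -aX => u v /XY Yuv; move: Yxy; rewrite -{1}aY => Yxy.
exact: Yxy _ _ Yuv.
Qed.

Lemma restr_closure_sub T B : selfadjoint dot B -> restr_closure dot T B `<=` B.
Proof.
move=> saB; have [_ cB] := selfadjoint_closed saB.
rewrite {2}((closure_id B).1 cB); apply: closureS; by move=> p [].
Qed.

Lemma restr_closure_eq T B : selfadjoint dot B ->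
  B.`1 `<=` (restr_closure dot T B).`1 -> restr_closure dot T B = B.
Proof.
move=> saB dB; apply/seteqP; split; first exact: restr_closure_sub.
move=> [x y] Bxy; have [|z Cxz] := dB x; first by exists y.
have [[_ _ opB] _ _] := saB.
by rewrite (opB _ _ _ Bxy (restr_closure_sub saB Cxz)).
Qed.

Lemma adjoint_biadjoint T : closed_operator T -> adj (adj T) = T.
Proof.
move=> [ oT cT]; rewrite (adjointK (subspace_op oT)).
exact/esym/(closure_id T).1.
Qed.

Lemma adjoint_densely_defined T : closed_operator T -> densely_defined (adj T).
Proof.
move=> [ oT cT]; apply: adjoint_dense; first exact: subspace_op.
move=> z; rewrite -((closure_id T).1 cT) => Tz.
by have [T0 _ opT] := oT; exact: opT Tz T0.
Qed.

Lemma subspace_graph (g g' : H -> H) :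
  (forall x y, dot (g x) y = dot x (g' y)) -> subspace (graph g').
Proof.
move=> gg'; split; first by rewrite /= (adjoint_fun0 gg').
by move=> a [u1 u2] [v1 v2] /= -> ->; rewrite (adjoint_funP gg').
Qed.

Section FactorClosed.
Variables (T L : set (H * H)) (g g' : H -> H).
Hypothesis gg' : forall x y, dot (g x) y = dot x (g' y).
Hypothesis g'0 : forall y, g' y = 0 -> y = 0.
Hypothesis T_closed : closed_operator T.
Hypothesis TL : T = [set p | exists2 l, L (p.1, l) & p.2 = g' l].
Hypothesis sL : subspace L.

Lemma factor_inj x y : g' x = g' y -> x = y.
Proof.
move=> e; apply/subr0_eq/g'0.
by rewrite (adjoint_funB gg') e subrr.
Qed.

(** If (x, y) is in the closure of L then (x, g' y) is in the closure of g' L,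
    which is T; injectivity of g' gives back (x, y). *)
Lemma factor_closed : closed_operator L.
Proof.
have [[_ _ opT] _] := T_closed.
split.
  have [L0 lL] := sL; split=> // x y z Ly Lz; apply: factor_inj.
  by apply: (opT x); rewrite TL; [exists y | exists z].
apply/closure_id/seteqP; split; first exact: subset_closure.
move=> [x y] cxy.
have : T (x, g' y).
  rewrite -(adjoint_biadjoint T_closed) => u v Auv /=.
  rewrite -gg'; apply: dot_flip.
  apply: (closure_annihilator cxy) => p l Lpl.
  have /= <- := Auv p (g' l); last by rewrite TL; exists l.
  by apply: dot_flip; rewrite gg'.
rewrite TL => -[l /= Lxl /factor_inj ->]; exact: Lxl.
Qed.

Lemma factor_adjoint x y : adj T (x, y) <-> adj L (g x, y).
Proof.
split=> h u v.
  move=> Luv /=; rewrite -(h u (g' v)) /=; last by rewrite TL; exists v.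
  by apply: dot_flip; rewrite gg'.
rewrite TL => -[l /= Lul ->]; rewrite -(h _ _ Lul) /=.
by apply: dot_flip; rewrite -gg'.
Qed.

End FactorClosed.

(** * The operator B_F of a quasi-affinity *)

Section QuasiAffinityFactor.
Variables (G S : set (H * H)).
Hypotheses (qG : quasi_affinity G) (nS : nonneg_selfadjoint dot S).

Local Notation Q := (op_sqrt dot S).

Lemma quasi_affinityP : exists g g' c, [/\ G = graph g, 0 <= c,
    forall x, rnorm (g' x) <= c * rnorm x,
    forall x y, dot (g x) y = dot x (g' y) &
    (forall x, g x = 0 -> x = 0) /\ (forall x, g' x = 0 -> x = 0)].
Proof.
have [bG injG rG] := qG.
have [g [g' [c [GE c0 _ bg' gg']]]] := bounded_operatorP bG.
have sG : subspace G by apply: subspace_op; case: bG.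
exists g, g', c; split=> //; split=> x x0.
  apply: (injG _ _ 0); last exact: sG.1.
  by rewrite GE /graph /= x0.
apply: (denseP (subspace_ran sG)).1 => // y [u]; rewrite GE /graph /= => ->.
by rewrite gg' x0 dot0r.
Qed.

Variables g g' : H -> H.
Hypotheses (GE : G = graph g) (gg' : forall x y, dot (g x) y = dot x (g' y)).
Hypothesis g0 : forall x, g x = 0 -> x = 0.

(** This is S^{1/2} (adj G^{-1}), as [sqrt_factorE] shows: the relation
    adj G^{-1} consists of the pairs (g' v, v). *)
Definition sqrt_factor : set (H * H) :=
  [set p | exists2 v, p.1 = g' v & Q (v, p.2)].

Lemma sqrt_factorE : op_mul Q (adj (op_inv G)) = sqrt_factor.
Proof.
apply/seteqP; split=> -[x y] /=.
  move=> [v h Qvy]; exists v => //=; apply: dot_ext => z; apply: dot_flip.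
  by rewrite -gg'; apply: (h (g z) z); rewrite /op_inv /= GE.
move=> [v /= -> Qvy]; exists v => // u w; rewrite /op_inv /= GE /graph /= => ->.
by rewrite gg'.
Qed.

Lemma subspace_sqrt_factor : subspace sqrt_factor.
Proof.
rewrite -sqrt_factorE; apply: subspace_mul; last exact: subspace_adjoint.
by apply: subspace_op; have [[[]]] := op_sqrtP nS.
Qed.

Lemma adjoint_sqrt_factor y z : adj sqrt_factor (y, z) <-> Q (y, g z).
Proof.
have [[[oQ dQ aQ] _] _] := op_sqrtP nS.
rewrite -{1}aQ; split=> h u v.
  move=> Quv /=; rewrite (h (g' u) v) /=; last by exists u.
  by apply: dot_flip; rewrite gg'.
by move=> [w /= -> /h /= ->]; apply: dot_flip; rewrite gg'.
Qed.

(** The outer factor G^{-1} S^{1/2} of B_F is the adjoint of the inner one, so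
    B_F falls under von Neumann's theorem. *)
Lemma op_BFE :
  op_BF dot G S = op_mul (adj (closure sqrt_factor)) (closure sqrt_factor).
Proof.
rewrite /op_BF sqrt_factorE adjoint_closure.
apply/seteqP; split=> -[x z] /=.
  move=> [w [y /= cxy Qyw]]; rewrite /op_inv /= GE => /= wz.
  by exists y => //=; apply/adjoint_sqrt_factor; rewrite -wz.
move=> [y /= cxy /adjoint_sqrt_factor Qyz]; exists (g z) => /=.
  by exists y.
by rewrite GE.
Qed.

Lemma op_BF_nonneg : nonneg_selfadjoint dot (op_BF dot G S).
Proof.
rewrite op_BFE; apply: von_neumann.
- exact/subspace_closure/subspace_sqrt_factor.
- exact: closed_closure.
apply/denseP; first exact/subspace_dom/subspace_closure/subspace_sqrt_factor.
move=> a ha; have [[[oQ dQ _] _] _] := op_sqrtP nS.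
apply/g0/(denseP (subspace_dom (subspace_op oQ))).1 => // v [q Qvq].
rewrite dotC gg' -dotC; apply: ha; exists q; apply: subset_closure; by exists v.
Qed.

End QuasiAffinityFactor.

(** * The implications *)

Lemma op_le_mul_adjoint T L c : 0 <= c ->
  closed_operator T -> densely_defined T ->
  closed_operator L -> densely_defined L -> L.`1 `<=` T.`1 ->
  (forall x y z, T (x, y) -> L (x, z) -> rnorm y <= c * rnorm z) ->
  op_le dot (op_mul (adj T) T) (c ^+ 2) (op_mul (adj L) L).
Proof.
move=> c0 cT dT cL dL dom bnd.
have nT := von_neumann (subspace_op cT.1) cT.2 dT.
have nL := von_neumann (subspace_op cL.1) cL.2 dL.
split=> // [x [z Qz]|x y z QTy QLz].
  have [w Lxw _] := (sqrt_modulus cL nL x).2 _ Qz.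
  have [|t Txt] := dom x; first by exists w.
  by have [y ? _] := (sqrt_modulus cT nT x).1 _ Txt; exists y.
have [w Lxw wz] := (sqrt_modulus cL nL x).2 _ QLz.
have [t Txt ty] := (sqrt_modulus cT nT x).2 _ QTy.
rewrite sqrtr_sqr ger0_norm// !norm_rnorm -rmorphM lecR -wz -ty.
exact: bnd Txt Lxw.
Qed.

(** With q = B^{1/2} and Z = q g, the next two lemmas derive from the closedness
    of g' B that adj Z = g' q, and from this that the range of g contains a
    core of q. *)
Section SqrtCore.
Variables (B : set (H * H)) (g g' : H -> H).
Hypothesis nB : nonneg_selfadjoint dot B.
Hypothesis gg' : forall x y, dot (g x) y = dot x (g' y).
Hypothesis g'0 : forall x, g' x = 0 -> x = 0.
Hypothesis closed_g'B : closed (op_mul (graph g') B).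

Local Notation q := (op_sqrt dot B).

(** adj (q g) is the closure of g' q. That g' q is closed is seen through the
    resolvent r of q: it sends dom q into dom B, and q w can be recovered from
    B r w since w = r w + q (r w). *)
Lemma adjoint_sqrt_mul s t : adj (op_mul q (graph g)) (s, t) ->
  op_mul (graph g') q (s, t).
Proof.
have [nq qq] := op_sqrtP nB; have [[oq _ adjq] _] := nq.
have sq := subspace_op oq; have sg' := subspace_graph gg'.
set M := op_mul (graph g') q.
have sM : subspace M by exact: subspace_mul.
move=> Zst; have cM : closure M (s, t).
  rewrite -adjointK// => v w Mvw; apply: Zst; exists (g v); first by [].
  rewrite -adjq => p b qpb /=.
  have /= <- := Mvw p (g' b); last by exists b.
  by apply: dot_flip; rewrite gg'.
have [r [sr hr]] := resolvent_fun nq.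
(* The continuous map (w, t) |-> (r w, t - g' (w - r w)) sends M into g' B. *)
have : op_mul (graph g') B (r s, t - g' (s - r s)).
  rewrite ((closure_id _).1 closed_g'B); apply: closure_biorthogonal.
    by apply: subspace_mul => //; apply: subspace_op; have [[]] := nB.
  move=> a b hab.
  have flip x y : dot (g' x) y = dot x (g y) by apply: dot_flip; rewrite gg'.
  suff : dot s (r a + (g b - r (g b))) = dot t b.
    rewrite dotBl flip dotBl !sr dotDr dotBr => <-; ring.
  apply: (closure_annihilator cM) => p _ [p' /= qp ->].
  have qrp : q (p - r p, p' - (p - r p)) by have := subspaceB sq qp (hr p).
  have Brp : B (r p, p' - (p - r p)).
    by rewrite -{1}qq; exists (p - r p); [exact: hr | exact: qrp].
  have := hab (r p) (g' (p' - (p - r p))) (ex_intro2 _ _ _ Brp erefl).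
  rewrite !flip !sr dotDr dotBr => ->; rewrite !dotBl !sr; ring.
move=> [b1 /=]; rewrite -{1}qq => -[c1 /= qrc qcb] tE.
have [_ _ opq] := oq; rewrite (opq _ _ _ qrc (hr s)) in qcb.
exists (s - r s + b1).
  have := subspaceD sq (hr s) qcb.
  by congr (q (_, _)); rewrite /= addrC subrK.
by rewrite /= (adjoint_funD gg') -tE addrC subrK.
Qed.

(** If (p, q p) is orthogonal to the restricted graph then (q p, - g' p) is in
    adj (q g), so that g' B p = - g' p, B p = - p and p = 0. *)
Lemma sqrt_core : q `<=` closure (restrict_op q (graph g).`2).
Proof.
have [nq qq] := op_sqrtP nB; have [oq cq] := selfadjoint_closed nq.1.
have sq := subspace_op oq.
apply: core_criterion => //.
- apply: subspace_restrict => //; apply/subspace_ran/subspace_graph => x y.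
  by apply: dot_flip; rewrite gg'.
- by move=> p [].
move=> p p' qp h.
have : adj (op_mul q (graph g)) (p', - g' p).
  move=> v w [_ /= -> qvw]; rewrite dotNr -gg'; apply/eqP.
  rewrite -addr_eq0 addrC; apply/eqP.
  by apply: h; split=> //; exists v.
move=> /adjoint_sqrt_mul[b /= qpb gE].
have bp : b = - p.
  apply/eqP; rewrite -addr_eq0; apply/eqP/g'0.
  by rewrite (adjoint_funD gg') -gE addNr.
have : B (p, - p) by rewrite -bp -qq; exists p'.
move=> /nB.2/resolvent_bound[]; rewrite subrr rnorm0 => p0 _.
exact: rnorm_le0.
Qed.

End SqrtCore.

Section Equivalence.
Variable T : set (H * H).
Hypotheses (T_closed : closed_operator T) (T_dense : densely_defined T).

Lemma quasi_affine_to_op_le (G S : set (H * H)) :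
  nonneg_selfadjoint dot S -> quasi_affine G (adj T) S ->
  T.`1 `<=` (restr_closure dot T (op_BF dot G S)).`1 ->
  exists (lambda : R) (B : set (H * H)),
      [/\ 0 <= lambda, nonneg_selfadjoint dot B,
          op_le dot (op_mul (adj T) T) lambda (op_mul (adj T) B),
          B.`1 `<=` T.`1 & T.`1 `<=` (restr_closure dot T B).`1].
Proof.
move=> nS [qG GT] domT.
have [g [g' [c [GE c0 bg' gg' [g0 g'0]]]]] := quasi_affinityP qG.
have nB := op_BF_nonneg nS GE gg' g0.
set B := op_BF dot G S in domT nB *.
have BE : B = _ := op_BFE nS GE gg'.
have [[saQ _] QQ] := op_sqrtP nS.
have [_ _ adjQ] := saQ.
(* (adj G) G B_F is contained in T: pair x with u in dom (adj T), use
   S G u = G (adj T) u, and move S^{1/2} to the other side. *)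
have ABT x z : B (x, z) -> T (x, g' (g z)).
  rewrite BE => -[y /= cxy]; rewrite adjoint_closure.
  move=> /(adjoint_sqrt_factor nS gg') Qyz.
  rewrite -(adjoint_biadjoint T_closed) => u t Aut /=.
  have /GT [w /=] : op_mul G (adj T) (u, g t) by exists t => //; rewrite GE.
  rewrite GE -QQ => /= -> [s /= Qgs Qst].
  have : adj (op_sqrt dot S) (y, g z) by rewrite adjQ.
  move=> /(_ _ _ Qgs) /= e; rewrite -gg' -e; apply: dot_flip.
  apply: (closure_annihilator cxy) => p q [v /= -> Qvq].
  have : adj (op_sqrt dot S) (s, g t) by rewrite adjQ.
  by move=> /(_ _ _ Qvq) /= ->; apply: dot_flip; rewrite gg'.
pose L := op_mul (graph g) B.
have TE : T = [set p | exists2 l, L (p.1, l) & p.2 = g' l].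
  apply/seteqP; split=> -[x t] /=; last by move=> [_ [z /= /ABT + ->] ->].
  move=> Txt; have [|z Cxz] := domT x; first by exists t.
  have Bxz := restr_closure_sub nB.1 Cxz; exists (g z); first by exists z.
  by have [[_ _ opT] _] := T_closed; exact: opT Txt (ABT _ _ Bxz).
have sB := selfadjoint_subspace nB.1.
have sL : subspace L.
  rewrite /L -GE; apply: subspace_mul => //; apply: subspace_op.
  by have [[]] := qG.
have cL := factor_closed gg' g'0 T_closed TE sL.
have BL : op_mul (adj T) B = op_mul (adj L) L.
  apply/seteqP; split=> -[x w] /=.
    move=> [z /= Bxz /(factor_adjoint gg' TE) Lzw]; exists (g z) => //.
    by exists z.
  by move=> [_ /= [z /= Bxz ->] /(factor_adjoint gg' TE) Azw]; exists z.
have domBT : B.`1 `<=` T.`1 by move=> x [z /ABT Tx]; eexists; exact: Tx.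
exists (c ^+ 2), B; split=> //; first exact: sqr_ge0.
rewrite BL; apply: op_le_mul_adjoint => //.
- apply/seteqP; split=> //; have [_ <- _] := nB.1.
  by apply: closureS => x [z Bxz]; exists (g z); exists z.
- by move=> x [_ [z /= Bxz _]]; apply: domBT; exists z.
- move=> x y l; rewrite {1}TE => -[l' /= Ll' ->] Ll.
  by have [[_ _ opL] _] := cL; rewrite (opL _ _ _ Ll' Ll).
Qed.

Lemma op_le_to_factorization (lambda : R) (B : set (H * H)) :
  dense_range T -> 0 <= lambda -> nonneg_selfadjoint dot B ->
  op_le dot (op_mul (adj T) T) lambda (op_mul (adj T) B) ->
  B.`1 `<=` T.`1 -> T.`1 `<=` (restr_closure dot T B).`1 ->
  exists B A : set (H * H),
      [/\ nonneg_selfadjoint dot B, bounded_nonneg dot A,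
          Ll2_factorization dot T A (restr_closure dot T B) & dense_range A].
Proof.
move=> rT l0 nB [_ nD domQ leQ] domB domT.
have rcB : restr_closure dot T B = B.
  by apply: restr_closure_eq nB.1 _ => x /domB/domT.
set D := op_mul (adj T) B in nD domQ leQ.
have [[saQ _] QQ] := op_sqrtP nD.
set Q := op_sqrt dot D in domQ leQ saQ QQ.
have [oQ _ adjQ] := saQ; have sQ := subspace_op oQ.
have sT := subspace_op T_closed.1.
have nT := von_neumann sT T_closed.2 T_dense.
pose c := Num.sqrt lambda.
have c0 : 0 <= c by exact: sqrtr_ge0.
(* The closure of Gam is a bounded operator W, X = adj W and A = W (adj W). *)
pose Gam := [set p : H * H | exists2 x, D.`1 x & Q (x, p.1) /\ T (x, p.2)].
have sG : subspace Gam.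
  have sD := subspace_dom (selfadjoint_subspace nD.1).
  split; first by exists 0; [exact: sD.1 | split; [exact: sQ.1 | exact: sT.1]].
  move=> a [u1 u2] [v1 v2] [x Dx [/= Qx Tx]] [z Dz [/= Qz Tz]].
  exists (a *: x + z); first exact: sD.2.
  by split; [exact: (sQ.2 a (x, u1) (z, v1)) | exact: (sT.2 a (x, u2) (z, v2))].
have bG y t : Gam (y, t) -> rnorm t <= c * rnorm y.
  move=> [x Dx [/= Qxy Txt]].
  have [z Qz zt] := (sqrt_modulus T_closed nT x).1 _ Txt.
  by rewrite -zt; have := leQ _ _ _ Qz Qxy; rewrite !norm_rnorm -rmorphM lecR.
have bcG := closure_bound c0 bG.
pose X := adj Gam.
have sX : subspace X := @subspace_adjoint Gam.
have XX : adj X = closure Gam := adjointK sG.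
have nA : nonneg_selfadjoint dot (op_mul (adj X) X).
  apply: von_neumann => //; first exact: closed_adjoint.
  apply: adjoint_dense => // z /bcG; rewrite rnorm0 mulr0 => z0.
  exact: rnorm_le0.
set A := op_mul (adj X) X in nA.
have bA y t : A (y, t) -> rnorm t <= c ^+ 2 * rnorm y.
  move=> [k /= Xyk]; rewrite XX => ckt.
  have tk := bcG _ _ ckt.
  have e : dot t y = dot k k.
    by move: Xyk; rewrite /X -adjoint_closure => /(_ _ _ ckt).
  have kk : rnorm k ^+ 2 <= rnorm t * rnorm y.
    by rewrite -rdotxx /rdot -e; exact: rdot_le.
  have k1 : rnorm k <= c * rnorm y.
    have [->|k0] := eqVneq (rnorm k) 0; first by rewrite mulr_ge0// rnorm_ge0.
    have k_gt0 : 0 < rnorm k by rewrite lt_neqAle eq_sym k0 rnorm_ge0.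
    rewrite -(ler_pM2l k_gt0) -expr2; apply: le_trans kk _.
    by rewrite mulrA ler_wpM2r ?rnorm_ge0// mulrC.
  apply: le_trans tk _; rewrite expr2 -mulrA ler_wpM2l//.
have cA := selfadjoint_closed nA.1.
have [oA dA adjA] := nA.1.
have domA : A.`1 = setT := bounded_full_domain cA dA (sqr_ge0 c) bA.
have bndA : bounded_operator A.
  split=> //; exists (c ^+ 2) => x y /bA h.
  by rewrite !norm_rnorm -rmorphM lecR.
have core x b t : D.`1 x -> B (x, b) -> T (x, t) -> A (b, t).
  move=> [d Dxd] Bxb Txt.
  have [b' /= Bxb' Abd] := Dxd; have [[_ _ opB] _ _] := nB.1.
  rewrite (opB _ _ _ Bxb' Bxb) in Abd.
  have [y /= Qxy Qyd] : op_mul Q Q (x, d) by rewrite QQ.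
  exists y => /=.
    move=> y' t' [x' _ [/= Qxy' Txt']]; rewrite (Abd _ _ Txt') /=.
    by rewrite -adjQ in Qyd; rewrite (Qyd _ _ Qxy').
  by rewrite XX; apply: subset_closure; exists x => //; exists d.
have ABT x b : B (x, b) -> forall t, A (b, t) -> T (x, t).
  rewrite -rcB => cxb t; rewrite -{1}adjA => Abt.
  rewrite -(adjoint_biadjoint T_closed) => u w Auw /=.
  have [a Aua] : A.`1 u by rewrite domA.
  rewrite -(Abt _ _ Aua) /=; apply: dot_flip.
  apply: (closure_annihilator cxb) => p q [/= Bpq Dp].
  have [tp Tp] := domB p (ex_intro _ q Bpq).
  rewrite -(Auw _ _ Tp) /=; have := core _ _ _ Dp Bpq Tp.
  move: Aua; rewrite -{1}adjA => Aua /Aua /=; exact.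
exists B, A; rewrite rcB; split=> //.
  split=> //; apply/seteqP.
  split=> -[x t] /=; last by move=> [b /= /ABT]; apply.
  move=> Txt; have [|b] := domT x; first by exists t.
  rewrite rcB => Bxb; have [t' Abt] : A.`1 b by rewrite domA.
  exists b => //=; have [[_ _ opT] _] := T_closed.
  by rewrite (opT _ _ _ Txt (ABT _ _ Bxb _ Abt)).
apply/seteqP; split=> //; rewrite -rT; apply: closureS => t [x Txt].
have [|b] := domT x; first by exists t.
rewrite rcB => Bxb; have [t' Abt] : A.`1 b by rewrite domA.
have [[_ _ opT] _] := T_closed.
by exists b; rewrite (opT _ _ _ Txt (ABT _ _ Bxb _ Abt)).
Qed.

Lemma bounded_sqrt_operator (A : set (H * H)) : bounded_nonneg dot A ->
  dense_range A -> exists g,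
  [/\ symmetric_fun g, forall x, g x = 0 -> x = 0,
      quasi_affinity (graph g) & A = [set p | p.2 = g (g p.1)]].
Proof.
move=> [bA nA] rA; have [a [_ [c [AE c0 ba _ _]]]] := bounded_operatorP bA.
have [nQ QQ] := op_sqrtP nA; set Q := op_sqrt dot A in nQ QQ *.
have [[oQ dQ adjQ] _] := nQ; have sQ := subspace_op oQ.
have domQ : Q.`1 = setT.
  apply/seteqP; split=> // x _.
  have [y /= Qxy _] : op_mul Q Q (x, a x) by rewrite QQ AE.
  by exists y.
have bQ x y : Q (x, y) -> rnorm y <= (c + 1) * rnorm x.
  move=> Qxy; have [y' /= Qxy'] : op_mul Q Q (x, a x) by rewrite QQ AE.
  have [_ _ opQ] := oQ; rewrite (opQ _ _ _ Qxy' Qxy) -{1}adjQ.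
  move=> /(_ _ _ Qxy) /= e.
  rewrite -(@ler_pXn2r _ 2) ?nnegrE ?mulr_ge0 ?addr_ge0 ?rnorm_ge0//.
  rewrite -rdotxx /rdot e -/(rdot _ _); apply: le_trans (rdot_le _ _) _.
  have := ler_wpM2l (rnorm_ge0 x) (ba x); move=> /le_trans; apply.
  have x2 : 0 <= rnorm x ^+ 2 by rewrite sqr_ge0.
  have h : 0 <= (1 + c + c ^+ 2) * rnorm x ^+ 2.
    by rewrite mulr_ge0// !addr_ge0// sqr_ge0.
  by move: h; rewrite exprMn; lra.
have bndQ : bounded_operator Q.
  by split=> //; exists (c + 1) => x y /bQ h; rewrite !norm_rnorm -rmorphM lecR.
have [g [_ [_ [GE _ _ _ _]]]] := bounded_operatorP bndQ.
have hg x : Q (x, g x) by rewrite GE.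
have sg : symmetric_fun g.
  move=> x y; have : adj Q (y, g y) by rewrite adjQ.
  by move=> /(_ _ _ (hg x)).
have AE' : A = [set p | p.2 = g (g p.1)].
  rewrite -QQ GE; apply/seteqP; split=> -[x y] /=; first by move=> [z /= -> ->].
  by move=> ->; exists (g x).
have g0 x : g x = 0 -> x = 0.
  move=> x0.
  apply: (denseP (subspace_ran (selfadjoint_subspace nA.1))).1 => // y [u].
  by rewrite AE' /= => ->; rewrite sg x0 dot0r.
exists g; split=> //; rewrite -GE; split=> //.
  move=> x y z; rewrite GE /graph /= => -> e.
  by apply/subr0_eq/g0; rewrite (adjoint_funB sg) e subrr.
apply/(denseP (subspace_ran sQ)) => x hx; apply: g0; apply: dot_eq0.
by rewrite -sg; apply: hx; exists (g x).
Qed.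

Lemma factorization_to_quasi_affine (B A : set (H * H)) :
  nonneg_selfadjoint dot B -> bounded_nonneg dot A ->
  Ll2_factorization dot T A (restr_closure dot T B) -> dense_range A ->
  exists G S : set (H * H),
      [/\ nonneg_selfadjoint dot S,
          quasi_affine G (adj T) S
        & T.`1 `<=` (restr_closure dot T (op_BF dot G S)).`1].
Proof.
move=> nB bA [_ _ nrc TE] rA.
have rcB : restr_closure dot T B = B.
  by apply: selfadjoint_max nrc.1 nB.1 _; apply: restr_closure_sub nB.1.
rewrite rcB in TE.
have [g [sg g0 qG AE]] := bounded_sqrt_operator bA rA.
have gg : forall x y, dot (g x) y = dot x (g y) := sg.
have sgr : subspace (graph g) := subspace_graph gg.
have [nq qq] := op_sqrtP nB; set q := op_sqrt dot B in nq qq.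
have [[oq dq adjq] _] := nq; have sq := subspace_op oq.
have sB := selfadjoint_subspace nB.1.
have TL : T = [set p | exists2 l, op_mul (graph g) B (p.1, l) & p.2 = g l].
  rewrite {1}TE AE; apply/seteqP; split=> -[x t] /=.
    by move=> [b /= Bxb ->]; exists (g b) => //; exists b.
  by move=> [_ [b /= Bxb ->] ->]; exists b.
have [_ cL] : closed_operator (op_mul (graph g) B).
  by apply: (factor_closed gg g0 T_closed TL); exact: subspace_mul.
pose Z := op_mul q (graph g).
have sZ : subspace Z by exact: subspace_mul.
have cZ : closed Z.
  apply/closure_id/seteqP; split=> [|[v w] cvw]; first exact: subset_closure.
  exists (g v) => //; rewrite -adjq => u t qut /=; apply: dot_flip; rewrite gg.
  apply: (closure_annihilator cvw) => p r [_ /= ->]; rewrite -{1}adjq => qpr.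
  by rewrite -gg; apply: dot_flip; exact: qpr _ _ qut.
have TB x y : adj T (x, y) -> B (g (g x), y).
  move=> Axy; have [_ _ <-] := nB.1 => u b Bub /=; rewrite -!gg.
  by apply: (Axy u (g (g b))); rewrite TL; exists (g b) => //; exists b.
have dZ : densely_defined Z.
  apply/(denseP (subspace_dom sZ)) => a ha; apply: g0.
  apply: (denseP (subspace_dom (@subspace_adjoint T))).1.
    exact: adjoint_densely_defined.
  move=> x [y /TB]; rewrite -qq => -[s /= qxs _]; rewrite -gg; apply: ha.
  by exists s; exists (g (g x)).
pose S := op_mul (adj Z) Z.
have nS : nonneg_selfadjoint dot S by exact: von_neumann.
have saBF : selfadjoint dot (op_BF dot (graph g) S).
  by have [] := op_BF_nonneg nS erefl gg g0.
exists (graph g), S; split=> //.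
  split=> // -[x y] [z /= Axz]; rewrite /graph /= => ->.
  have := TB _ _ Axz; rewrite -qq => -[s /= qxs]; rewrite -{1}adjq => qsz.
  exists (g x) => //; exists s => /=; first by exists (g (g x)).
  by move=> v w [_ /= -> /qsz /= ->]; rewrite gg.
(* Both operators are selfadjoint, so one inclusion makes them equal. *)
suff BBF : B `<=` op_BF dot (graph g) S.
  rewrite -(selfadjoint_max nB.1 saBF BBF) rcB TE.
  by move=> x [t [b /= Bxb _]]; exists b.
have [nQ QQ] := op_sqrtP nS.
move=> [x z]; rewrite -{1}qq => -[s /= qxs qsz].
rewrite (op_BFE nS erefl gg).
pose L1 := restrict_op q (graph g).`2.
have cxs := sqrt_core nB gg g0 cL qxs.
set Q := op_sqrt dot S in nQ QQ.
have [[oQ dQ adjQ] _] := nQ; have sQ := subspace_op oQ; have [_ _ opQ] := oQ.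
have cQ := selfadjoint_closed nQ.1.
have clZ : closed_operator Z.
  split=> //; split; [exact: sZ.1 | exact: sZ.2 |].
  move=> v w w' [_ /= -> qw] [_ /= -> qw'].
  by have [_ _ opq] := oq; exact: opq qw qw'.
have g_inj u v : g u = g v -> u = v.
  by move=> e; exact: (factor_inj gg g0 e).
have sL1 : subspace L1.
  by apply: subspace_restrict => //; exact: subspace_ran.
have sF := subspace_sqrt_factor nS erefl gg.
have Zof u v w : q (u, w) -> u = g v -> Z (v, w).
  by move=> quw uE; exists (g v) => //=; rewrite -uE.
have dom12 : L1.`1 `<=` (sqrt_factor S g).`1.
  move=> u [w [/= quw [v /= uE]]].
  have [r Qvr _] := (sqrt_modulus clZ nS v).1 _ (Zof _ _ _ quw uE).
  by exists r; exists v.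
have bnd12 u w y : L1 (u, w) -> sqrt_factor S g (u, y) ->
    rnorm y <= 1 * rnorm w.
  move=> [/= quw _] [v /= uE Qvy].
  have [r Qvr rw] := (sqrt_modulus clZ nS v).1 _ (Zof _ _ _ quw uE).
  by rewrite mul1r -rw (opQ _ _ _ Qvy Qvr).
(* For x in dom B take G v -> x with B^{1/2} G v -> B^{1/2} x; since
   |S^{1/2} v| = |B^{1/2} G v|, the vectors S^{1/2} v converge to some y. *)
have [y [cxy _ hy]] := transfer ler01 sL1 sF dom12 bnd12 cxs.
exists y => //; rewrite adjoint_closure; apply/(adjoint_sqrt_factor nS gg).
(* S^{1/2} y = G B x may be tested on dom S, a core of S^{1/2}. *)
rewrite -/Q -adjQ => v r Qvr /=; apply: esym.
apply: (closure_annihilator (core_mul_adjoint cQ.1 cQ.2 Qvr)).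
move=> {Qvr}v {}r [Qvr [d]].
rewrite adjQ QQ /= => Svd.
have [w /= Zvw Awd] := Svd.
have [r' /= Qvr'] : op_mul Q Q (v, d) by rewrite QQ.
rewrite (opQ _ _ _ Qvr' Qvr) -{1}adjQ => Qrd.
have yr : dot y r = dot s w.
  apply: hy => u w' y' [/= quw' _] [v' /= uE Qvy'].
  by rewrite (Qrd _ _ Qvy') (Awd _ _ (Zof _ _ _ quw' uE)).
rewrite -gg (dot_flip yr); have [_ /= -> qvw] := Zvw.
by move: qsz; rewrite -{1}adjq => /(_ _ _ qvw) /= ->.
Qed.
End Equivalence.

End Hilbert.

Theorem theorem2p18 (R : realType) (H : completeNormedModType R[i])
    (dot : {dot H for @Num.conj R[i]})
    (dot_norm : forall x : H, `|x| ^+ 2 = dot x x)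
    (T : set (H * H)) (T_closed : closed_operator T)
    (T_dense : densely_defined T) (T_range : dense_range T) :
  [<->
    (* (i) *)
    exists (lambda : R) (B : set (H * H)),
      [/\ 0 <= lambda,
          nonneg_selfadjoint dot B,
          op_le dot (op_mul (adjoint dot T) T) lambda
                    (op_mul (adjoint dot T) B),
          B.`1 `<=` T.`1
        & T.`1 `<=` (restr_closure dot T B).`1];
    (* (ii) *)
    exists B A : set (H * H),
      [/\ nonneg_selfadjoint dot B,
          bounded_nonneg dot A,
          Ll2_factorization dot T A (restr_closure dot T B)
        & dense_range A];
    (* (iii) *)
    exists G S : set (H * H),
      [/\ nonneg_selfadjoint dot S,
          quasi_affine G (adjoint dot T) S
        & T.`1 `<=` (restr_closure dot T (op_BF dot G S)).`1]].
Proof.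
tfae.
- move=> [lambda [B [l0 nB le domB domT]]].
  exact: op_le_to_factorization T_range l0 nB le domB domT.
- move=> [B [A [nB bA fac rA]]].
  exact: factorization_to_quasi_affine nB bA fac rA.
- move=> [G [S [nS qa domT]]].
  exact: quasi_affine_to_op_le nS qa domT.
Qed.
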